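(* Let $k$ be a field, $n\ge 1$, and $S=k[x_1,\dots,x_n]$ with the standard grading. Let $2\le a_1\le\cdots\le a_n$ be integers and let $I$ be a graded ideal of $S$ containing a regular sequence $f_1,\dots,f_n$ of homogeneous polynomials with $\deg(f_i)=a_i$ such that, for every $1\le i\le n$, $f_i$ splits into linear factors (i.e. $f_i$ is a product of elements of $S_1$). Then there is a graded ideal $J$ of $S$ containing $x_1^{a_1},\dots,x_n^{a_n}$ such that $\dim_k (S/I)_t=\dim_k (S/J)_t$ for all $t\ge 0$.
   Context: $S=\bigoplus_{d\ge0}S_d$ is graded by $\deg(x_i)=1$ for all $i$. A graded (homogeneous) ideal is a proper ideal having a system of homogeneous generators. *)

(* Defs.v *)
From mathcomp Require Import all_boot all_order all_algebra.
From mathcomp Require Import ring_quotient.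
From mathcomp Require Export mpoly.

Set Implicit Arguments.
Unset Strict Implicit.
Unset Printing Implicit Defensive.

Import GRing.Theory.
Local Open Scope ring_scope.

(* The ideal (G) of R, as a Prop-valued membership predicate. *)
Definition gen_ideal (R : comNzRingType) (G : R -> Prop) (p : R) : Prop :=
  exists (r : nat) (c g : 'I_r -> R),
    (forall j, G (g j)) /\ p = \sum_(j < r) c j * g j.

(* [idealr_closed] includes properness, [1 \notin I]. *)
Definition graded_ideal (n : nat) (k : fieldType) (I : {pred {mpoly k[n]}}) :
    Prop :=
  idealr_closed I /\
  exists G : {mpoly k[n]} -> Prop,
    (forall g, G g -> exists d : nat, g \is d.-homog) /\
    (forall p, p \in I <-> gen_ideal G p).

Definition regular_sequence (R : comNzRingType) (r : nat) (f : 'I_r -> R) :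
    Prop :=
  (forall (i : 'I_r) (g : R),
     let previous p := exists2 j : 'I_r, (j < i)%N & p = f j in
     gen_ideal previous (g * f i) -> gen_ideal previous g) /\
  ~ gen_ideal (fun p => exists j : 'I_r, p = f j) 1.

Definition splits_into_linear_factors (n : nat) (k : fieldType)
    (p : {mpoly k[n]}) : Prop :=
  exists s : seq {mpoly k[n]},
    (forall l, l \in s -> l \is 1.-homog) /\ p = \prod_(l <- s) l.

(* dim_k (S/I)_t = m for S = k[x_1, ..., x_n]: there are m forms of degree t
   whose residue classes modulo I are a k-basis of (S/I)_t = S_t / (I \cap S_t). *)
Definition dim_quotient (n : nat) (k : fieldType) (I : {pred {mpoly k[n]}})
    (t m : nat) : Prop :=
  exists b : 'I_m -> {mpoly k[n]},
    [/\ forall j, b j \is t.-homog,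
        forall c : 'I_m -> k,
          \sum_(j < m) c j *: b j \in I -> forall j, c j = 0
      & forall p : {mpoly k[n]}, p \is t.-homog ->
          exists c : 'I_m -> k, p - \sum_(j < m) c j *: b j \in I].

(* Main.v *)
Require Import Defs.
From mathcomp Require Import all_boot all_order all_algebra.
From mathcomp Require Import mpoly.
From HB Require Import structures.
From mathcomp Require Import zify ring.
From Stdlib Require Import Classical ClassicalEpsilon.

Import GRing.Theory.

(** Why the theorem holds.  A function h is the Hilbert function of S/J for some
    graded ideal J containing the powers x_i^{a_i} as soon as h(0) = 1 and a numerical
    growth condition holds.  Let M_t be the set of monomials of degree t with all exponents
    of x_i below a_i.  In M_t take the |M_t| - h(t) lexicographically largest monomials;
    if the shadow of this segment in M_{t+1} has at most |M_{t+1}| - h(t+1) elements for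
    every t, these segments and the monomials outside the box span such an ideal
    ([lpp], a lex-plus-powers ideal), because the shadow of a segment is a segment
    ([shadow_upclosed]).  So the theorem reduces to bounding the growth of the Hilbert
    function of S/I, which is [hilb_growth].

    The bound is proved for ideals K containing products of linear forms
    F_i = prod L_i (i < m) such that K and any transversal l_i in L_i generate all
    variables; this hypothesis survives the induction on m without any change of ring.
    Order the factors l_1, ..., l_a of F_m and put
    E_j = (K : l_1 ... l_j) + (l_{j+1}).  Exact sequences give
    H(S/K, t) = sum_j H(S/E_j, t - j), and E_j satisfies the hypothesis with m - 1
    products.  For a fixed degree d, choosing at each step the factor that maximizes
    the Hilbert function in the relevant degree forces
    H(S/E_{j+1}, d - j) <= H(S/E_j, d - j) ([greedy_filtration]).  This is what is needed
    to stack the segments of the m - 1 variable problems, as slices x_m^j, into a set of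
    monomials of degree d in m variables whose shadow is no larger than allowed
    ([growth_slices]).  The Clements-Lindstrom theorem ([clements_lindstrom_all]) then
    replaces the stacked set by a lexicographic segment of the same size.

    The Clements-Lindstrom theorem is proved by induction on the number n of variables.
    Compressing a set along a coordinate (replacing each slice by a segment) preserves
    the size and does not enlarge the shadow.  For n >= 3 a set of minimal lexicographic
    weight is therefore fixed by all compressions, hence stable under replacing the last
    variable, the one with the largest bound, by any other; for such sets the comparison
    with the segment is direct ([cl_stable]).  Two variables are treated by hand.

    Finally a regular sequence f_1, ..., f_n of split forms satisfies the transversal
    hypothesis ([regular_transversal]): each f_i takes a difference of the Hilbert
    function, so S/(f) vanishes in large degrees, the f_i have no common zero besides
    the origin, and the matrix of any transversal is invertible. *)

Set Implicit Arguments.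
Unset Strict Implicit.
Unset Printing Implicit Defensive.

(** * Initial segments of a finite totally ordered set *)

Section InitialSegments.
Variables (T : finType) (gt : rel T).
Implicit Types (M : {set T}) (u v : T).
Hypothesis gt_irr : irreflexive gt.
Hypothesis gt_trans : transitive gt.
Hypothesis gt_total : forall u v, u != v -> gt u v || gt v u.

Definition rank (M : {set T}) v := #|[set u in M | gt u v]|.
Definition seg (M : {set T}) s := [set v in M | rank M v < s].

Lemma rank_lt M u v : u \in M -> gt u v -> rank M u < rank M v.
Proof.
move=> uM uv; apply: proper_card; apply/properP; split.
  by apply/subsetP=> w; rewrite !inE => /andP[-> /gt_trans]; apply.
by exists u; rewrite !inE uM ?uv // gt_irr.
Qed.

Lemma rank_inj M : {in M &, injective (rank M)}.
Proof.
move=> u v uM vM e; apply/eqP/negPn/negP => /gt_total/orP[] g.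
  by have := rank_lt uM g; rewrite e ltnn.
by have := rank_lt vM g; rewrite e ltnn.
Qed.

Lemma rank_max M v : v \in M -> rank M v < #|M|.
Proof.
move=> vM; apply: proper_card; apply/properP; split.
  by apply/subsetP=> w; rewrite inE => /andP[].
by exists v; rewrite // !inE gt_irr andbF.
Qed.

Lemma seg_sub M s : seg M s \subset M.
Proof. by apply/subsetP=> v; rewrite inE => /andP[]. Qed.

(** [rank M] is injective on [M], so a set is no larger than any set of ranks it uses;
    this bounds [seg M s] from above by [s] and its complement by [#|M| - s]. *)
Lemma card_rank_image (M D : {set T}) m (E : {set 'I_m}) :
  D \subset M -> (forall v, v \in D -> exists2 i : 'I_m, i \in E & i = rank M v :> nat) ->
  #|D| <= #|E|.
Proof.
case: (set_0Vmem D) => [-> _ _|[v0 v0D] sDM DE]; first by rewrite cards0.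
case: m E DE => [|m] E DE; first by have [[]] := DE _ v0D.
have inj : {in D &, injective (fun v => inord (rank M v) : 'I_m.+1)}.
  have rD v : v \in D -> rank M v < m.+1 by case/DE=> i _ <-.
  move=> u v uD vD /(congr1 val); rewrite /= !inordK ?rD //.
  by apply: rank_inj; exact: (subsetP sDM).
rewrite -(card_in_imset inj); apply/subset_leq_card/subsetP=> _ /imsetP[v vD ->].
by have [i iE <-] := DE _ vD; rewrite inord_val.
Qed.

Lemma card_seg M s : s <= #|M| -> #|seg M s| = s.
Proof.
move=> sM; apply/eqP; rewrite eqn_leq; apply/andP; split.
  rewrite -[leqRHS]card_ord -cardsT; apply: (@card_rank_image M); first exact: seg_sub.
  by move=> v; rewrite inE => /andP[_ lt]; exists (Ordinal lt).
have: #|M :\: seg M s| <= #|~: [set i : 'I_#|M| | i < s]|.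
  apply: (@card_rank_image M); first exact: subsetDl.
  move=> v /setDP[vM]; rewrite inE vM /= => ns.
  by exists (Ordinal (rank_max vM)); rewrite // !inE.
have -> : #|~: [set i : 'I_#|M| | i < s]| = #|M| - s.
  have := cardsC [set i : 'I_#|M| | i < s]; rewrite card_ord.
  suff -> : #|[set i : 'I_#|M| | i < s]| = s by lia.
  rewrite cardE -(size_map val) -[RHS](size_iota 0); apply/perm_size/uniq_perm.
  - by rewrite map_inj_uniq ?enum_uniq //; exact: val_inj.
  - exact: iota_uniq.
  move=> i; rewrite mem_iota add0n /=; apply/mapP/idP => [[j]|lt].
    by rewrite mem_enum inE => lt ->.
  by exists (Ordinal (leq_trans lt sM)); rewrite // mem_enum inE.
have := seg_sub M s => /setIidPr e; have := cardsID (seg M s) M; rewrite e; lia.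
Qed.

Lemma seg_up M s u v : v \in seg M s -> u \in M -> gt u v -> u \in seg M s.
Proof.
rewrite !inE => /andP[vM lt] uM /(rank_lt uM) lt'.
by rewrite uM (ltn_trans lt').
Qed.

Lemma seg_le M s s' : s <= s' -> seg M s \subset seg M s'.
Proof.
move=> le; apply/subsetP=> v; rewrite !inE => /andP[-> /leq_trans]; exact.
Qed.

(** An up-closed subset contains everything above each of its elements, so the ranks of
    its elements stay below its size. *)
Lemma seg_uniq (M L : {set T}) : L \subset M ->
  (forall u v, v \in L -> u \in M -> gt u v -> u \in L) -> L = seg M #|L|.
Proof.
move=> sLM up; apply/eqP; rewrite eqEcard card_seg ?leqnn ?subset_leq_card // andbT.
apply/subsetP=> v vL; rewrite inE (subsetP sLM) //=.
apply: proper_card; apply/properP; split.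
  by apply/subsetP=> u; rewrite inE => /andP[uM] /up; apply.
by exists v; rewrite // !inE gt_irr andbF.
Qed.

Lemma card_seg_le M s : #|seg M s| <= s.
Proof.
case: (leqP s #|M|) => [/card_seg -> //|/ltnW lt].
exact: leq_trans (subset_leq_card (seg_sub _ _)) lt.
Qed.

(** The potential argument behind compression: replacing a set by the segment of the same
    size swaps elements for larger ones, so a function decreasing along the order has a
    strictly smaller sum. *)
Lemma seg_sum_lt (M C W : {set T}) (f : T -> nat) :
  (forall u v, gt u v -> f u < f v) ->
  W \subset M -> C = seg M #|W| -> C != W ->
  \sum_(v in C) f v < \sum_(v in W) f v.
Proof.
move=> fd WM Cdef neq.
have cC : #|C| = #|W| by rewrite Cdef card_seg ?subset_leq_card.
rewrite (big_setID W) [ltnRHS](big_setID C) /= setIC ltn_add2l.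
have cD : #|C :\: W| = #|W :\: C|.
  by have := cardsID W C; have := cardsID C W; rewrite setIC; lia.
have [w wD] : exists w, w \in W :\: C.
  apply/set0Pn; rewrite -card_gt0 -cD card_gt0; apply: contra neq.
  by rewrite setD_eq0 eqEcard cC leqnn andbT.
have [w0 w0D w0min] := arg_minnP f wD.
have lt c : c \in C :\: W -> f c < f w0.
  move=> /setDP[cC' cW]; move: w0D => /setDP[wW wC]; apply: fd.
  have /gt_total/orP[//|g] : c != w0 by apply: contraNneq cW => ->.
  have := cC'; rewrite Cdef => /seg_up/(_ (subsetP WM _ wW) g).
  by rewrite -Cdef (negPf wC).
apply: (@leq_trans (\sum_(v in C :\: W) f w0)).
  have [c cD'] : exists c, c \in C :\: W.
    by apply/set0Pn; rewrite -card_gt0 cD card_gt0; apply/set0Pn; exists w.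
  rewrite (big_setD1 c) //= [leqRHS](big_setD1 c) //= -addSn leq_add ?lt //.
  by apply: leq_sum => v /setD1P[_ /lt/ltnW].
rewrite sum_nat_const cD -sum_nat_const; apply: leq_sum => v; exact: w0min.
Qed.

End InitialSegments.

(** * Exponent vectors, lexicographic order and shadows *)

Section Vectors.
Variable B : nat.

(** Exponents are bounded by a global [B] only to make the type finite; the boxes [a] in
    use always satisfy [a i <= B.+1]. *)
Record vec n := Vec { vec_val : {ffun 'I_n -> 'I_B.+1} }.
HB.instance Definition _ n := [isNew for @vec_val n].
HB.instance Definition _ n := [Finite of vec n by <:].

Definition vec_fun n (v : vec n) (i : 'I_n) : nat := vec_val v i.
Coercion vec_fun : vec >-> Funclass.

Lemma vec_ext n (u v : vec n) : (forall i, u i = v i) -> u = v.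
Proof. by move=> e; apply: val_inj; apply/ffunP=> i; apply: val_inj; apply: e. Qed.

Lemma vec_le n (v : vec n) i : v i <= B.
Proof. by rewrite -ltnS; apply: ltn_ord. Qed.

Definition mkvec n (f : 'I_n -> nat) : vec n := Vec [ffun i => inord (f i)].

Lemma mkvecE n (f : 'I_n -> nat) i : f i <= B -> mkvec f i = f i.
Proof. by move=> le; rewrite /vec_fun ffunE inordK. Qed.

Definition deg n (v : vec n) := \sum_i v i.

(** Index 0 is the most significant, so the last variable is the smallest. *)
Definition lex n (u v : vec n) :=
  [exists i : 'I_n, (v i < u i) && [forall j : 'I_n, (j < i) ==> (u j == v j)]].

Definition in_box n (a : 'I_n -> nat) (v : vec n) := [forall i, v i < a i].

Definition box n (a : 'I_n -> nat) d : {set vec n} :=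
  [set v | in_box a v && (deg v == d)].

Definition covers n (i : 'I_n) (v w : vec n) :=
  [forall j, w j == v j + (j == i)].

(** Exponent vectors stand for monomials: these are the products by one variable that are
    nonzero modulo the powers x_i^(a i). *)
Definition shadow n (a : 'I_n -> nat) (V : {set vec n}) : {set vec n} :=
  [set w | in_box a w && [exists v in V, exists i, covers i v w]].

Lemma in_boxP n (a : 'I_n -> nat) (v : vec n) : reflect (forall i, v i < a i) (in_box a v).
Proof. exact: forallP. Qed.

Lemma coversP n (i : 'I_n) (v w : vec n) :
  reflect (forall j, w j = v j + (j == i)) (covers i v w).
Proof. by apply: (iffP forallP) => h j; apply/eqP. Qed.

Lemma shadowP n (a : 'I_n -> nat) (V : {set vec n}) w :
  reflect (in_box a w /\ exists2 v, v \in V & exists i, covers i v w) (w \in shadow a V).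
Proof.
rewrite inE; apply: (iffP andP) => -[? ex]; split=> //.
  by case/exists_inP: ex => v vV /existsP ?; exists v.
by case: ex => v vV /existsP ?; apply/exists_inP; exists v.
Qed.

Lemma lexP n (u v : vec n) :
  reflect (exists2 i, v i < u i & forall j : 'I_n, j < i -> u j = v j) (lex u v).
Proof.
apply: (iffP existsP) => [[i /andP[lt /forallP eq]]|[i lt eq]]; exists i => //.
  by move=> j ji; apply/eqP; have := eq j; rewrite ji.
by rewrite lt; apply/forallP=> j; apply/implyP=> /eq ->.
Qed.

Lemma lex_irr n : irreflexive (@lex n).
Proof. by move=> u; apply/lexP => -[i]; rewrite ltnn. Qed.

Lemma lex_trans n : transitive (@lex n).
Proof.
move=> v u w /lexP[i lt eq] /lexP[j lt' eq']; apply/lexP.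
case: (ltngtP i j) => [ij|ji|/val_inj ij].
- exists i; first by rewrite -eq'.
  by move=> k ki; rewrite eq // eq' // (ltn_trans ki).
- exists j; first by rewrite eq.
  by move=> k kj; rewrite eq ?eq' // (ltn_trans kj).
exists i; first by rewrite (leq_trans _ lt) // ij ltnS ltnW.
by move=> k ki; rewrite eq ?eq' // -ij.
Qed.

Lemma lex_total n (u v : vec n) : u != v -> lex u v || lex v u.
Proof.
move=> neq; have [i0 ni0] : exists i, u i != v i.
  by apply/existsP; rewrite -negb_forall; apply: contra neq => /forallP e; apply/eqP/vec_ext=> i; apply/eqP.
have [i ni imin] := @arg_minnP _ i0 (fun i => u i != v i) (@nat_of_ord n) ni0.
have eq (j : 'I_n) : j < i -> u j = v j.
  by move=> ji; apply/eqP/negPn/negP => /imin; rewrite leqNgt ji.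
case: (ltngtP (u i) (v i)) ni => [lt|lt|//].
  by move=> _; apply/orP; right; apply/lexP; exists i => // j /eq.
by move=> _; apply/orP; left; apply/lexP; exists i.
Qed.

Lemma deg_lt n (u v : vec n) l : (forall k, u k <= v k) -> u l < v l -> deg u < deg v.
Proof.
move=> le lt; rewrite /deg (bigD1 l) //= [ltnRHS](bigD1 l) //= -addSn.
by apply: leq_add => //; apply: leq_sum.
Qed.

Lemma deg_covers n i (v w : vec n) : covers i v w -> deg w = (deg v).+1.
Proof.
move/coversP=> e; rewrite /deg (eq_bigr _ (fun j _ => e j)) big_split /=.
rewrite -[RHS]addn1; congr addn; rewrite (bigD1 i) //= eqxx big1 // => j /negPf-> //.
Qed.

Lemma boxP n (a : 'I_n -> nat) d (v : vec n) :
  reflect ((forall i, v i < a i) /\ deg v = d) (v \in box a d).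
Proof.
by rewrite inE; apply: (iffP andP) => -[/in_boxP ? /eqP ?]; split=> //; exact/in_boxP.
Qed.

Lemma shadow_sub_box n (a : 'I_n -> nat) d (V : {set vec n}) :
  V \subset box a d -> shadow a V \subset box a d.+1.
Proof.
move=> s; apply/subsetP=> w /shadowP[bw [v /(subsetP s)/boxP[_ dv] [i c]]].
by apply/boxP; split; [exact/in_boxP|rewrite (deg_covers c) dv].
Qed.

Lemma lower n i (w : vec n) : 0 < w i -> {v | covers i v w}.
Proof.
move=> wi; exists (mkvec (fun j => w j - (j == i))); apply/coversP=> j.
rewrite mkvecE; last by exact: leq_trans (leq_subr _ _) (vec_le _ _).
by case: eqP => [->|]; rewrite ?subn0 ?addn0 //=; lia.
Qed.

Definition upclosed n (M V : {set vec n}) :=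
  forall u v, v \in V -> u \in M -> lex u v -> u \in V.

(** Let [u] be above [w], which covers [v], and lower [u] in its last nonzero coordinate.
    The coordinate where [u] first exceeds [w] is affected only if all later ones are zero,
    and then equality of degrees decides; so the result is not below [v]. *)
Lemma shadow_upclosed n (a : 'I_n -> nat) d (V : {set vec n}) : V \subset box a d ->
  upclosed (box a d) V -> upclosed (box a d.+1) (shadow a V).
Proof.
move=> sV upV u w /shadowP[bw [v vV [i0 c]]] /boxP[bu du] /lexP[i lt eq].
apply/shadowP; split; first exact/in_boxP.
have ui : 0 < u i by exact: leq_ltn_trans lt.
(* j is the last coordinate where u is positive. *)
have [j uj jmax] := @arg_maxnP _ i (fun j => 0 < u j) (@nat_of_ord n) ui.
have [u' c'] := lower uj; exists u'; last by exists j.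
have /boxP[_ dv] := subsetP sV _ vV.
have ub : u' \in box a d.
  apply/boxP; split; last by have := deg_covers c'; rewrite du => -[].
  by move=> k; have := bu k; have := coversP _ _ _ c' k; lia.
have [-> //|/lex_total/orP[|]] := eqVneq u' v; first exact: upV.
move=> /lexP[l ltl eql].
have vw k : v k <= w k by rewrite (coversP _ _ _ c k) leq_addr.
have ij := jmax _ ui.
move/coversP: c' => c'.
have cl := c' l; have ci := c' i; have vl := vw l; have vi := vw i.
case: (ltngtP i l) => [il|li|/val_inj il].
- have e : v i = u' i by rewrite eql.
  have ej : i = j by apply/eqP; move: ci; case: eqP => //= _; lia.
  have : deg u' < deg v.
    apply: (@deg_lt _ _ _ l) => // k; case: (ltngtP k l) => [kl|lk|/val_inj->]; last exact: ltnW.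
      by rewrite eql.
    have := c' k; case: (posnP (u k)) => [->|/jmax kj _].
      by move/esym/eqP; rewrite addn_eq0 => /andP[/eqP -> _].
    by move: kj lk il; rewrite /= -ej; lia.
  by rewrite dv; move/boxP: ub => [_ ->]; rewrite ltnn.
- have e : u l = w l by rewrite eq.
  by move: cl; case: eqP => [e'|] /=; last lia; move: li; rewrite e'; lia.
by move: cl; rewrite -il in ltl vl *; lia.
Qed.

Definition ins n (k : 'I_n.+1) (j : 'I_B.+1) (u : vec n) : vec n.+1 :=
  Vec [ffun i => if unlift k i is Some i' then vec_val u i' else j].
Definition del n (k : 'I_n.+1) (v : vec n.+1) : vec n :=
  Vec [ffun i => vec_val v (lift k i)].
Definition slice n (k : 'I_n.+1) j (W : {set vec n.+1}) := [set u | ins k j u \in W].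

Lemma ins_at n k j (u : vec n) : ins k j u k = j.
Proof. by rewrite /vec_fun ffunE unlift_none. Qed.
Lemma ins_lift n k j (u : vec n) i : ins k j u (lift k i) = u i.
Proof. by rewrite /vec_fun ffunE liftK. Qed.
Lemma del_at n k (v : vec n.+1) i : del k v i = v (lift k i).
Proof. by rewrite /vec_fun ffunE. Qed.
Lemma insK n k j : cancel (@ins n k j) (del k).
Proof. by move=> u; apply/vec_ext=> i; rewrite del_at ins_lift. Qed.
Lemma delK n k (v : vec n.+1) : ins k (vec_val v k) (del k v) = v.
Proof.
apply/vec_ext=> i; case: (unliftP k i) => [i'|] ->; first by rewrite ins_lift del_at.
by rewrite ins_at.
Qed.

Lemma lift_forall n (k : 'I_n.+1) (P : 'I_n.+1 -> Prop) :
  P k -> (forall i, P (lift k i)) -> forall i, P i.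
Proof. by move=> Pk Pl i; case: (unliftP k i) => [i'|] ->. Qed.

Lemma ltn_lift n (k : 'I_n.+1) i j : (lift k i < lift k j) = (i < j).
Proof. by rewrite /= !ltnNge leq_bump2. Qed.

Lemma deg_ins n k j (u : vec n) : deg (ins k j u) = j + deg u.
Proof.
by rewrite /deg (bigD1_ord k) //= ins_at; congr (_ + _); apply: eq_bigr => i _; rewrite ins_lift.
Qed.

Lemma lex_ins n k j (u v : vec n) : lex (ins k j u) (ins k j v) = lex u v.
Proof.
apply/lexP/lexP => -[i].
  case: (unliftP k i) => [i'|] ->; last by rewrite !ins_at ltnn.
  rewrite !ins_lift => lt eq; exists i' => // j' lt'.
  by have := eq (lift k j'); rewrite ltn_lift !ins_lift; apply.
move=> lt eq; exists (lift k i); first by rewrite !ins_lift.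
apply: (@lift_forall _ k); first by rewrite !ins_at.
by move=> j'; rewrite ltn_lift !ins_lift; exact: eq.
Qed.

Lemma sum_slices n k (W : {set vec n.+1}) (f : vec n.+1 -> nat) :
  \sum_(v in W) f v = \sum_j \sum_(u in slice k j W) f (ins k j u).
Proof.
rewrite (partition_big (fun v : vec n.+1 => vec_val v k) xpredT) //=; apply: eq_bigr => j _.
rewrite (reindex_onto (ins k j) (del k)) /=; last by move=> v /andP[_ /eqP <-]; rewrite delK.
by apply: eq_bigl => u; rewrite ffunE unlift_none insK !eqxx !andbT inE.
Qed.

Lemma card_slices n k (W : {set vec n.+1}) : #|W| = \sum_j #|slice k j W|.
Proof.
by rewrite -sum1_card (sum_slices k); apply: eq_bigr => j _; rewrite sum1_card.
Qed.

Definition del_bound n (k : 'I_n.+1) (a : 'I_n.+1 -> nat) i := a (lift k i).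

Lemma in_box_ins n (a : 'I_n.+1 -> nat) k j (u : vec n) :
  in_box a (ins k j u) = (j < a k) && in_box (del_bound k a) u.
Proof.
apply/in_boxP/andP => [h|[jk /in_boxP h]].
  split; first by have := h k; rewrite ins_at.
  by apply/in_boxP=> i; have := h (lift k i); rewrite ins_lift.
by apply: (@lift_forall _ k) => [|i]; rewrite ?ins_at // ins_lift; exact: h.
Qed.

Lemma slice_box n (a : 'I_n.+1 -> nat) d k (j : 'I_B.+1) :
  slice k j (box a d) = if (j < a k) && (j <= d) then box (del_bound k a) (d - j) else set0.
Proof.
apply/setP=> u; rewrite inE inE in_box_ins deg_ins.
case: (ltnP j (a k)) => //= _; last by rewrite inE.
case: leqP => jd; rewrite !inE; case: (in_box _ _) => //=; last by lia.
by apply/eqP/eqP; move: jd; lia.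
Qed.

Lemma covers_ins n k j (u v : vec n) i : covers (lift k i) (ins k j u) (ins k j v) = covers i u v.
Proof.
apply/coversP/coversP => h j'.
  by have := h (lift k j'); rewrite !ins_lift (inj_eq lift_inj).
case: (unliftP k j') => [i'|] ->; first by rewrite !ins_lift (inj_eq lift_inj).
by rewrite !ins_at (negPf (neq_lift _ _)) addn0.
Qed.

(** A cover of [v] either raises another coordinate, staying in the same slice, or raises
    coordinate [k] itself.  Hence slice [j] of a shadow is the union of the shadow of slice
    [j] with slice [j - 1]; the three inclusions follow. *)
Lemma slice_shadow_cases n (a : 'I_n.+1 -> nat) k j (V : {set vec n.+1}) u :
  u \in slice k j (shadow a V) ->
  u \in shadow (del_bound k a) (slice k j V) \/
  exists j' : 'I_B.+1, j'.+1 = j /\ u \in slice k j' V.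
Proof.
rewrite inE => /shadowP[]; rewrite in_box_ins => /andP[jk bu] [v vV [i]].
rewrite -(delK k v) in vV *; case: (unliftP k i) => [i'|] -> c.
  have e := coversP _ _ _ c k; rewrite !ins_at (negPf (neq_lift _ _)) addn0 in e.
  have {}e := val_inj e; left; apply/shadowP; split=> //; rewrite e.
  exists (del k v); first by rewrite inE.
  by exists i'; rewrite e covers_ins in c.
right; exists (vec_val v k); split.
  by have := coversP _ _ _ c k; rewrite !ins_at eqxx addn1.
suff -> : u = del k v by rewrite inE.
apply: vec_ext => l.
have := coversP _ _ _ c (lift k l); rewrite !ins_lift => ->.
by rewrite eq_sym (negPf (neq_lift _ _)) addn0.
Qed.

Lemma slice_shadow_same n (a : 'I_n.+1 -> nat) k (j : 'I_B.+1) (V : {set vec n.+1}) : j < a k ->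
  shadow (del_bound k a) (slice k j V) \subset slice k j (shadow a V).
Proof.
move=> jk; apply/subsetP=> u /shadowP[bu [v vV [i c]]]; rewrite inE; apply/shadowP.
rewrite in_box_ins jk; split=> //; exists (ins k j v); first by rewrite inE in vV.
by exists (lift k i); rewrite covers_ins.
Qed.

Lemma slice_shadow_prev n (a : 'I_n.+1 -> nat) d k (j j' : 'I_B.+1) (V : {set vec n.+1}) :
  V \subset box a d -> j < a k -> j'.+1 = j -> slice k j' V \subset slice k j (shadow a V).
Proof.
move=> sV jk jj; apply/subsetP=> u; rewrite !inE => uV.
have /boxP[/in_boxP] := subsetP sV _ uV; rewrite !in_box_ins => /andP[_ bu] _.
rewrite jk bu; apply/exists_inP; exists (ins k j' u) => //; apply/existsP; exists k.
apply/coversP=> i; case: (unliftP k i) => [i'|] ->; last by rewrite !ins_at eqxx addn1.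
by rewrite !ins_lift eq_sym (negPf (neq_lift _ _)) addn0.
Qed.

Lemma slice_shadow0 n (a : 'I_n.+1 -> nat) k (j : 'I_B.+1) (V : {set vec n.+1}) : a k <= j ->
  slice k j (shadow a V) = set0.
Proof.
by move=> h; apply/setP=> u; rewrite !inE in_box_ins ltnNge h.
Qed.

End Vectors.

(** * Compression along a coordinate *)

Section Compression.
Variable B : nat.
Local Notation vec := (vec B).

Definition lseg n (a : 'I_n -> nat) d s : {set vec n} := seg (@lex B n) (box B a d) s.

Lemma lseg_sub n (a : 'I_n -> nat) d s : lseg a d s \subset box B a d.
Proof. exact: seg_sub. Qed.

Lemma lseg_upclosed n (a : 'I_n -> nat) d s : upclosed (box B a d) (lseg a d s).
Proof. by move=> u v; apply: seg_up; [exact: lex_irr|exact: lex_trans]. Qed.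

Lemma seg_upclosed n (M : {set vec n}) s : upclosed M (seg (@lex B n) M s).
Proof. by move=> u v; apply: seg_up; [exact: lex_irr|exact: lex_trans]. Qed.

Lemma card_lseg n (a : 'I_n -> nat) d s : s <= #|box B a d| -> #|lseg a d s| = s.
Proof. apply: card_seg; [exact: lex_irr|exact: lex_trans|exact: lex_total]. Qed.

Lemma card_lseg_le n (a : 'I_n -> nat) d s : #|lseg a d s| <= s.
Proof. apply: card_seg_le; [exact: lex_irr|exact: lex_trans|exact: lex_total]. Qed.

Lemma upclosedE n (M L : {set vec n}) : L \subset M -> upclosed M L ->
  L = seg (@lex B n) M #|L|.
Proof. apply: seg_uniq; [exact: lex_irr|exact: lex_trans|exact: lex_total]. Qed.

(** Segments of the same set are nested, so that the size of their union is a maximum. *)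
Lemma upclosed_chain n (M L K : {set vec n}) : L \subset M -> upclosed M L ->
  K \subset M -> upclosed M K -> L \subset K \/ K \subset L.
Proof.
move=> sL /(upclosedE sL) -> sK /(upclosedE sK) ->.
by case: (leqP #|L| #|K|) => [|/ltnW] le; [left|right]; apply: seg_le.
Qed.

Lemma shadow0 n (a : 'I_n -> nat) : shadow a (set0 : {set vec n}) = set0.
Proof.
by apply/setP=> w; rewrite in_set0; apply/negbTE/shadowP=> -[_ [v]]; rewrite in_set0.
Qed.

Section Compress.
Variables (n : nat) (a : 'I_n.+1 -> nat) (d : nat) (k : 'I_n.+1).
Let a' := del_bound k a.

Definition stack (c : 'I_B.+1 -> nat) : {set vec n.+1} :=
  [set v in box B a d | del k v \in
     seg (@lex B n) (slice k (vec_val v k) (box B a d)) (c (vec_val v k))].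

Lemma stack_sub c : stack c \subset box B a d.
Proof. by apply/subsetP=> v; rewrite inE => /andP[]. Qed.

Lemma slice_stack c j : slice k j (stack c) = seg (@lex B n) (slice k j (box B a d)) (c j).
Proof.
apply/setP=> u; rewrite inE inE.
have -> : vec_val (ins k j u) k = j by rewrite ffunE unlift_none.
rewrite insK; case: (boolP (u \in seg _ _ _)) => [|_]; last by rewrite andbF.
by move/(subsetP (seg_sub _ _ _)); rewrite inE => ->.
Qed.

Lemma sliceS (V W : {set vec n.+1}) j : V \subset W -> slice k j V \subset slice k j W.
Proof. by move=> s; apply/subsetP=> u; rewrite !inE; apply: (subsetP s). Qed.

Lemma card_slice_stack c j : c j <= #|slice k j (box B a d)| ->
  #|slice k j (stack c)| = c j.
Proof.
rewrite slice_stack; apply: card_seg; [exact: lex_irr|exact: lex_trans|exact: lex_total].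
Qed.

(** Both parts of a slice of this shadow are segments of the same level, so the larger one
    contains the other and it suffices to bound each of them separately. *)
Lemma card_slice_shadow_stack c (g : 'I_B.+1 -> nat) :
  (forall j : 'I_B.+1, j < a k -> #|shadow a' (slice k j (stack c))| <= g j) ->
  (forall j j' : 'I_B.+1, j < a k -> j'.+1 = j -> #|slice k j' (stack c)| <= g j) ->
  forall j, #|slice k j (shadow a (stack c))| <= if j < a k then g j else 0.
Proof.
move=> g1 g2 j; case: ltnP => ja; last by rewrite slice_shadow0 // cards0.
have [[j' jj]|no] : (exists j' : 'I_B.+1, j'.+1 = j) \/ ~ exists j' : 'I_B.+1, j'.+1 = j.
- case: (posnP j) => [e|pos]; first by right=> -[j']; rewrite e.
  have lt : j.-1 < B.+1 by apply: leq_ltn_trans (leq_pred _) (ltn_ord j).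
  by left; exists (Ordinal lt); rewrite /= prednK.
- have sub : slice k j (shadow a (stack c)) \subset
      shadow a' (slice k j (stack c)) :|: slice k j' (stack c).
    apply/subsetP=> u /slice_shadow_cases[uU|[j'' [e us]]]; rewrite inE ?uU //.
    by rewrite (_ : j' = j'') ?us ?orbT //; apply: val_inj; apply: succn_inj; rewrite jj.
  have [s|s] : shadow a' (slice k j (stack c)) \subset slice k j' (stack c) \/
     slice k j' (stack c) \subset shadow a' (slice k j (stack c)); last first.
  + by rewrite (setUidPl s) in sub; apply: leq_trans (subset_leq_card sub) (g1 _ ja).
  + by rewrite (setUidPr s) in sub; apply: leq_trans (subset_leq_card sub) (g2 _ _ ja jj).
  have sb := sliceS _ (stack_sub c).
  case: (leqP j d) => jd; last first.
    left; suff -> : slice k j (stack c) = set0 by rewrite shadow0 sub0set.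
    by apply/eqP; rewrite -subset0; have := sb j; rewrite slice_box [j <= d]leqNgt jd andbF.
  have bj : slice k j (box B a d) = box B a' (d - j) by rewrite slice_box ja jd.
  have bj' : slice k j' (box B a d) = box B a' (d - j).+1.
    have -> : (d - j).+1 = d - j' by move: jj jd; lia.
    have ja' : j' < a k by move: jj ja; lia.
    have jd' : j' <= d by move: jj jd; lia.
    by rewrite slice_box ja' jd'.
  apply: (@upclosed_chain _ (box B a' (d - j).+1)).
  + by apply: shadow_sub_box; rewrite -bj.
  + by apply: shadow_upclosed; rewrite ?slice_stack -bj ?seg_sub //; exact: seg_upclosed.
  + by rewrite -bj'.
  by rewrite slice_stack bj'; exact: seg_upclosed.
apply: leq_trans (g1 _ ja); apply/subset_leq_card/subsetP=> u /slice_shadow_cases[//|].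
by move=> [j' [e _]]; case: no; exists j'.
Qed.

End Compress.

Definition clements_lindstrom n := forall a : 'I_n -> nat,
  (forall i, a i <= B.+1) -> (forall i j : 'I_n, i <= j -> a i <= a j) ->
  forall d (V : {set vec n}), V \subset box B a d ->
  #|shadow a (lseg a d #|V|)| <= #|shadow a V|.

Lemma del_bound_mono n (a : 'I_n.+1 -> nat) k : (forall i j : 'I_n.+1, i <= j -> a i <= a j) ->
  forall i j : 'I_n, i <= j -> del_bound k a i <= del_bound k a j.
Proof. by move=> h i j ij; apply: h; rewrite /= leq_bump2. Qed.

(** A potential that does not depend on the degree, so that it can be used in all slices
    at once. *)
Definition weight n := rank (@lex B n) setT.

Lemma weight_lt n (u v : vec n) : lex u v -> weight u < weight v.
Proof. by apply: rank_lt; [exact: lex_irr|exact: lex_trans|rewrite inE]. Qed.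

(** In each slice of the shadow of [C], the two segments to be compared have sizes bounded
    by those of the two subsets of the corresponding slice of the shadow of [V]. *)
Lemma compression n (a : 'I_n.+1 -> nat) d k (V : {set vec n.+1}) :
  clements_lindstrom n ->
  (forall i, a i <= B.+1) -> (forall i j : 'I_n.+1, i <= j -> a i <= a j) ->
  V \subset box B a d ->
  let C := stack a d k (fun j => #|slice k j V|) in
  [/\ #|C| = #|V|, #|shadow a C| <= #|shadow a V| &
      C != V -> \sum_(v in C) weight v < \sum_(v in V) weight v].
Proof.
move=> cl ab am sV C.
have cs j : #|slice k j C| = #|slice k j V|.
  by apply: card_slice_stack; apply/subset_leq_card/sliceS.
split.
- by rewrite (card_slices k) [RHS](card_slices k); apply: eq_bigr => j _; exact: cs.
- rewrite (card_slices k) [leqRHS](card_slices k); apply: leq_sum => j _.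
  apply: leq_trans (@card_slice_shadow_stack n a d k _ (fun j => #|slice k j (shadow a V)|) _ _ j) _.
  + move=> {}j ja; case: (leqP j d) => jd; last first.
      by rewrite slice_stack slice_box [j <= d]leqNgt jd andbF /= (_ : seg _ _ _ = set0) ?shadow0 ?cards0 //;
         apply/eqP; rewrite -subset0 seg_sub.
    apply: leq_trans (subset_leq_card (slice_shadow_same V ja)).
    rewrite slice_stack slice_box ja jd; apply: cl.
    * by move=> i; exact: ab.
    * exact: del_bound_mono.
    by have := sliceS k j sV; rewrite slice_box ja jd.
  + move=> {}j j' ja jj; rewrite cs; apply: subset_leq_card; exact: (slice_shadow_prev sV).
  by case: ifP.
move=> neq; rewrite (sum_slices k) [ltnRHS](sum_slices k).
have [j nj] : exists j, slice k j C != slice k j V.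
  apply/existsP; rewrite -negb_forall; apply: contra neq => /forallP e.
  apply/eqP/setP=> v; have /eqP/setP/(_ (del k v)) := e (vec_val v k).
  by rewrite !inE !delK.
have lt i : slice k i C != slice k i V ->
    \sum_(u in slice k i C) weight (ins k i u) < \sum_(u in slice k i V) weight (ins k i u).
  move=> ni.
  apply: (@seg_sum_lt _ (@lex B n) (@lex_irr B n) (@lex_trans B n) (@lex_total B n)
            (slice k i (box B a d))) => //; last 2 first.
  - exact: sliceS.
  - exact: slice_stack.
  by move=> u v uv; apply: weight_lt; rewrite lex_ins.
rewrite (bigD1 j) //= [ltnRHS](bigD1 j) //= -addSn leq_add ?lt //.
apply: leq_sum => i _; have [-> //|/lt/ltnW//] := eqVneq (slice k i C) (slice k i V).
Qed.

(** A set of minimal weight among those competing with [V] is fixed by the compressions in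
    all directions [k] simultaneously. *)
Lemma compressed_exists n (a : 'I_n.+1 -> nat) d (V : {set vec n.+1}) :
  clements_lindstrom n ->
  (forall i, a i <= B.+1) -> (forall i j : 'I_n.+1, i <= j -> a i <= a j) ->
  V \subset box B a d ->
  exists W : {set vec n.+1},
  [/\ W \subset box B a d, #|W| = #|V|, #|shadow a W| <= #|shadow a V| &
    forall k u v, v \in W -> u \in box B a d -> u k = v k -> lex u v -> u \in W].
Proof.
move=> cl ab am sV.
pose P (W : {set vec n.+1}) := [&& W \subset box B a d, #|W| == #|V| & #|shadow a W| <= #|shadow a V|].
have PV : P V by rewrite /P sV eqxx /=.
have [W /and3P[sW /eqP cW uW] Wmin] := arg_minnP (fun W : {set vec n.+1} => \sum_(v in W) weight v) PV.
exists W; split=> // k u v vW ub euv luv.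
have [cC uC lC] := compression k cl ab am sW.
have e : stack a d k (fun j => #|slice k j W|) = W.
  apply/eqP; apply: contraT => /lC; rewrite ltnNge Wmin // /P stack_sub cC cW eqxx /=.
  exact: leq_trans uC uW.
have euv' : vec_val u k = vec_val v k by exact: val_inj.
rewrite -e inE ub /=; rewrite -e inE in vW; case/andP: vW => _.
rewrite euv' => /seg_upclosed; apply; first by rewrite inE -euv' delK.
by rewrite -(lex_ins k (vec_val v k)) delK -euv' delK.
Qed.

Definition lower_last n (v : vec n.+1) : vec n.+1 := mkvec B (fun j => v j - (j == ord_max)).
Definition raise n i (v : vec n) : vec n := mkvec B (fun j => v j + (j == i)).

Lemma lower_lastE n (v : vec n.+1) j : lower_last v j = v j - (j == ord_max).
Proof. by rewrite mkvecE // (leq_trans (leq_subr _ _)) // vec_le. Qed.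

Lemma raiseE n (a : 'I_n -> nat) (v : vec n) i : (forall i, a i <= B.+1) -> (v i).+1 < a i ->
  forall j, raise i v j = v j + (j == i).
Proof.
move=> ab h j; rewrite mkvecE //; case: eqP => [->|_]; last by rewrite addn0 vec_le.
by have := ab i; rewrite addn1; move: h; lia.
Qed.

Lemma raise_covers n (a : 'I_n -> nat) (v : vec n) i : (forall i, a i <= B.+1) -> (v i).+1 < a i ->
  covers i v (raise i v).
Proof. by move=> ab h; apply/coversP/(raiseE ab h). Qed.

Lemma raise_shadow n (a : 'I_n -> nat) d (V : {set vec n}) (v : vec n) i :
  (forall i, a i <= B.+1) -> V \subset box B a d -> v \in V -> (v i).+1 < a i -> raise i v \in shadow a V.
Proof.
move=> ab sV vV h; apply/shadowP; split; last by exists v => //; exists i; exact: raise_covers ab h.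
apply/in_boxP=> j; rewrite (raiseE ab h); have /boxP[bv _] := subsetP sV _ vV.
by case: eqP => [->|_]; rewrite ?addn0 ?addn1.
Qed.

(** Dividing by the last variable maps the shadow of an up-closed set back into the set:
    if [w = v x_i] then [w / z] is lexicographically at least [v]. *)
Lemma card_shadow_lseg_pos n (a : 'I_n.+1 -> nat) d (L : {set vec n.+1}) :
  L \subset box B a d -> upclosed (box B a d) L ->
  #|[set w in shadow a L | 0 < w ord_max]| <= #|[set v in L | (v ord_max).+1 < a ord_max]|.
Proof.
move=> sL upL; rewrite -(card_in_imset (f := @lower_last n)); last first.
  move=> u v; rewrite !inE => /andP[_ pu] /andP[_ pv] /(congr1 (@vec_fun _ _)) e.
  apply: vec_ext => i; have := congr1 (fun f => f i) e; rewrite !lower_lastE.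
  by case: eqP => [->|_]; [move: pu pv; lia | rewrite !subn0].
apply/subset_leq_card/subsetP=> _ /imsetP[w wD ->].
move: wD; rewrite inE => /andP[wU pw].
have cw : covers ord_max (lower_last w) w.
  by apply/coversP=> j; rewrite lower_lastE; case: eqP => [->|_]; [move: pw; lia | rewrite subn0 addn0].
case/shadowP: (wU) => /in_boxP bw [v vL [i c]].
rewrite inE lower_lastE eqxx subn1 prednK // bw andbT.
have /boxP[bv dv] := subsetP sL _ vL.
have bd : lower_last w \in box B a d.
  apply/boxP; split; first by move=> j; rewrite lower_lastE (leq_ltn_trans (leq_subr _ _)).
  by apply: succn_inj; rewrite -dv -(deg_covers cw) (deg_covers c).
have [ei|ni] := eqVneq i ord_max.
  suff -> : lower_last w = v by [].
  apply: vec_ext => j; have := coversP _ _ _ c j; have := coversP _ _ _ cw j.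
  by rewrite ei => -> /addIn.
apply: (upL _ v) => //; apply/lexP; exists i.
  by rewrite lower_lastE (negPf ni) subn0 (coversP _ _ _ c) eqxx addn1.
move=> j ji; rewrite lower_lastE (coversP _ _ _ c).
have -> : (j == i) = false by apply/eqP => e; rewrite e ltnn in ji.
have -> : (j == ord_max) = false; last by rewrite addn0 subn0.
by apply/eqP=> e; move: ji; rewrite e /= ltnNge -ltnS ltn_ord.
Qed.

Lemma card_shadow_pos n (a : 'I_n.+1 -> nat) d (V : {set vec n.+1}) : (forall i, a i <= B.+1) ->
  V \subset box B a d ->
  #|[set v in V | (v ord_max).+1 < a ord_max]| <= #|[set w in shadow a V | 0 < w ord_max]|.
Proof.
move=> ab sV; rewrite -(card_in_imset (f := @raise n.+1 ord_max)).
  apply/subset_leq_card/subsetP=> _ /imsetP[v vD ->].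
  move: vD; rewrite inE => /andP[vV h].
  by rewrite inE (raise_shadow ab sV) // (raiseE ab h) eqxx addn1.
move=> u v; rewrite !inE => /andP[_ hu] /andP[_ hv] /(congr1 (@vec_fun _ _)) e.
apply: vec_ext => i; have := congr1 (fun f => f i) e.
by rewrite (raiseE ab hu) (raiseE ab hv) => /addIn.
Qed.

(** Closure under exchanging the last variable for any other one, inside the box. *)
Definition stable n (a : 'I_n.+1 -> nat) (V : {set vec n.+1}) :=
  forall i v w, v \in V -> in_box a w -> i != ord_max ->
  (forall j, w j + (j == ord_max) = v j + (j == i)) -> w \in V.

Lemma deg_move n (v w : vec n.+1) i :
  (forall j, w j + (j == ord_max) = v j + (j == i)) -> deg w = deg v.
Proof.
move=> h; have s1 (l : 'I_n.+1) : \sum_j (j == l) = 1.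
  by rewrite (bigD1 l) //= eqxx big1 // => j /negPf-> //.
have : \sum_j (w j + (j == ord_max)) = \sum_j (v j + (j == i)) by apply: eq_bigr => j _.
by rewrite !big_split /= !s1 !addn1 => -[].
Qed.

(** Walk from [v] up to [u] by moving units out of the last coordinate, choosing at each
    step a coordinate that keeps the vector lexicographically at most [u]. *)
Lemma stable_above n (a : 'I_n.+1 -> nat) d (V : {set vec n.+1}) : stable a V ->
  V \subset box B a d ->
  (forall u v, v \in V -> u \in box B a d -> u ord_max = v ord_max -> lex u v -> u \in V) ->
  forall u v, v \in V -> u \in box B a d -> lex u v -> u ord_max <= v ord_max -> u \in V.
Proof.
move=> stV sV zV u v; have [m le_m] := ubnP (v ord_max - u ord_max).
elim: m v le_m => // m IH v le_m vV ub /lexP[i lt eq].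
rewrite leq_eqVlt => /orP[/eqP e|ltz]; first by apply: zV e _ => //; apply/lexP; exists i.
have /boxP[bu du] := ub; have /boxP[bv dv] := subsetP sV _ vV.
have ni : i != ord_max by apply/eqP=> e; move: lt ltz; rewrite e; lia.
have step k : k != ord_max -> v k < u k ->
   exists w, [/\ w \in V, forall j, w j + (j == ord_max) = v j + (j == k) & deg w = d].
  move=> nk vk; pose w := mkvec B (fun j => v j + (j == k) - (j == ord_max)).
  have we j : w j = v j + (j == k) - (j == ord_max).
    rewrite mkvecE //; have := vec_le v j; case: eqP => [->|_]; last by rewrite addn0; lia.
    by rewrite (negPf nk) subn0 addn1 => _; apply: leq_trans vk (vec_le u _).
  have wm j : w j + (j == ord_max) = v j + (j == k).
    rewrite we subnK //; case: eqP => // ->; rewrite eq_sym (negPf nk) addn0.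
    exact: leq_ltn_trans ltz.
  exists w; split=> //; last by rewrite (deg_move wm).
  apply: (stV k v) => //; apply/in_boxP=> j; rewrite we.
  apply: (leq_ltn_trans (leq_subr _ _)); case: eqP => [->|_]; last by rewrite addn0.
  by rewrite addn1; apply: leq_ltn_trans vk (bu k).
have fin w k : k != ord_max -> w \in V -> (forall j, w j + (j == ord_max) = v j + (j == k)) -> lex u w -> u \in V.
  move=> nk wV wm luw; have wz := wm ord_max.
  rewrite eqxx [ord_max == k]eq_sym (negPf nk) in wz.
  by apply: (IH w) => //; clear -wz le_m ltz; lia.
(* Prefer a coordinate after the first difference i; when there is none, raise i itself,
   and if this uses up the difference at i, equality of degrees forces u = w. *)
have [/existsP[k /and3P[ik nk vk]]|none] :=
    boolP [exists k : 'I_n.+1, [&& i < k, k != ord_max & v k < u k]].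
  have [w [wV wm _]] := step k nk vk.
  apply: (fin w k nk wV wm); apply/lexP; exists i.
    suff -> : w i = v i by [].
    have := wm i; rewrite (negPf ni) addn0.
    by have -> : (i == k) = false by [apply/eqP=> e; rewrite e ltnn in ik]; rewrite addn0.
  move=> j ji; rewrite eq //; have := wm j.
  have -> : (j == k) = false by apply/eqP=> e; move: ji ik; rewrite e; lia.
  have -> : (j == ord_max) = false; last by rewrite !addn0.
  by apply/eqP=> e; move: ji; rewrite e /= ltnNge -ltnS ltn_ord.
have [w [wV wm dw]] := step i ni lt.
have [-> //|neq] := eqVneq u w.
have wi : w i = (v i).+1 by have := wm i; rewrite eqxx (negPf ni) addn0 addn1.
have wlt (j : 'I_n.+1) : j < i -> u j = w j.
  move=> ji; rewrite eq //; have := wm j.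
  have -> : (j == i) = false by apply/eqP=> e; rewrite e ltnn in ji.
  have -> : (j == ord_max) = false; last by rewrite !addn0.
  by apply/eqP=> e; move: ji; rewrite e /= ltnNge -ltnS ltn_ord.
apply: (fin w i ni wV wm).
move: lt; rewrite -wi leq_eqVlt => /orP[/eqP ei|lt]; last by apply/lexP; exists i.
have le j : u j <= w j.
  case: (ltngtP j i) => [ji|ij|/val_inj ->]; first by rewrite wlt.
    have := wm j; have -> : (j == i) = false by apply/eqP=> e; rewrite e ltnn in ij.
    have [->|nj] := eqVneq j ord_max; first by move: ltz; lia.
    rewrite !addn0 => ->; rewrite leqNgt; apply: contra none => vu.
    by apply/existsP; exists j; rewrite ij nj.
  by rewrite ei.
have [l nl] : exists l, u l != w l.
  apply/existsP; rewrite -negb_forall; apply: contra neq => /forallP e.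
  by apply/eqP/vec_ext => l; apply/eqP.
have : deg u < deg w by apply: (deg_lt le (l := l)); rewrite ltn_neqAle nl le.
by rewrite dw du ltnn.
Qed.

(** Split shadows by the exponent of the last variable [z].  Multiplication by [z] accounts
    for the part divisible by [z], up to the elements with maximal exponent of [z], of which
    the segment [L] has at least as many as [V]; the part free of [z] comes from elements
    free of [z], and those of [L] lie in [V].  Both comparisons hold because by
    [stable_above] a failure would make one of the two sets properly contain the other. *)
Lemma cl_stable n (a : 'I_n.+1 -> nat) d (V : {set vec n.+1}) :
  (forall i, a i <= B.+1) ->
  stable a V -> V \subset box B a d ->
  (forall u v, v \in V -> u \in box B a d -> u ord_max = v ord_max -> lex u v -> u \in V) ->
  #|shadow a (lseg a d #|V|)| <= #|shadow a V|.
Proof.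
move=> ab stV sV zV; have upV := stable_above stV sV zV.
set L := lseg a d #|V|.
have sL : L \subset box B a d := lseg_sub _ _ _.
have upL : upclosed (box B a d) L := @lseg_upclosed _ _ _ _.
have cL : #|L| = #|V| by apply: card_lseg; exact: subset_leq_card.
clearbody L.
have split (W : {set vec n.+1}) : #|W| = #|[set w in W | w ord_max == 0]| + #|[set w in W | 0 < w ord_max]|.
  rewrite -(cardsID [set w : vec n.+1 | w ord_max == 0] W); congr (_ + _);
    apply: eq_card => w; rewrite !inE // lt0n // andbC //.
have L0 v : v \in L -> v ord_max = 0 -> v \in V.
  move=> vL v0; apply: contraT => vV.
  have VL : V \proper L.
    apply/properP; split; last by exists v.
    apply/subsetP=> u uV; apply: contraT => uL.
    have /lex_total/orP[uv|vu] : u != v by apply: contraNneq uL => ->.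
      by rewrite (upL _ v) // (subsetP sV) in uL.
    by rewrite (upV v u) // ?(subsetP sL) // v0 in vV.
  by have := proper_card VL; rewrite cL ltnn.
have Ltop : [set v in V | ~~ ((v ord_max).+1 < a ord_max)] \subset
            [set v in L | ~~ ((v ord_max).+1 < a ord_max)].
  apply/subsetP=> v; rewrite !inE => /andP[vV top]; rewrite top andbT; apply: contraT => vL.
  have VL : L \proper V.
    apply/properP; split; last by exists v.
    apply/subsetP=> u uL; apply: (upV _ v) => //; first exact: (subsetP sL).
      have /lex_total/orP[//|vu] : u != v by apply: contraTneq uL => ->.
      by rewrite (upL _ u) // (subsetP sV) in vL.
    have /boxP[/(_ ord_max) bu _] := subsetP sL _ uL.
    by move: top; rewrite -leqNgt; lia.
  by have := proper_card VL; rewrite cL ltnn.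
rewrite (split (shadow a L)) [leqRHS]split; apply: leq_add.
  apply/subset_leq_card/subsetP=> w; rewrite !inE -!andbA => /and3P[bw /exists_inP[v vL vw] w0].
  rewrite bw w0 andbT; apply/exists_inP; exists v => //; apply: L0 => //.
  case/existsP: vw => i /coversP/(_ ord_max); rewrite (eqP w0) => /esym/eqP.
  by rewrite addn_eq0 => /andP[/eqP].
apply: leq_trans (card_shadow_lseg_pos sL upL) (leq_trans _ (card_shadow_pos ab sV)).
have := subset_leq_card Ltop.
pose T := [set v : vec n.+1 | (v ord_max).+1 < a ord_max].
have tE (W : {set vec n.+1}) : [set v in W | (v ord_max).+1 < a ord_max] = W :&: T.
  by apply/setP=> v; rewrite !inE.
have tE' (W : {set vec n.+1}) : [set v in W | ~~ ((v ord_max).+1 < a ord_max)] = W :\: T.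
  by apply/setP=> v; rewrite !inE andbC.
rewrite !tE !tE'; have := cardsID T L; have := cardsID T V; rewrite cL => eV eL le.
by rewrite -(leq_add2r #|L :\: T|) eL -eV leq_add2l.
Qed.

End Compression.

(** * The Clements-Lindstrom theorem *)

Section ClementsLindstrom.
Variable B : nat.
Local Notation vec := (vec B).
Local Notation clements_lindstrom := (clements_lindstrom B).

Lemma lseg_upclosedE n (a : 'I_n -> nat) d (V : {set vec n}) : V \subset box B a d ->
  upclosed (box B a d) V -> lseg B a d #|V| = V.
Proof. by move=> sV uV; rewrite [RHS](upclosedE sV uV). Qed.

Lemma cl_few_variables n : n <= 1 -> clements_lindstrom n.
Proof.
move=> n1 a _ _ d V sV; rewrite lseg_upclosedE // => u v vV uB /lexP[i lt _].
have /boxP[_ dv] := subsetP sV _ vV; have /boxP[_ du] := uB.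
have : deg v < deg u; last by rewrite dv du ltnn.
apply: (deg_lt (l := i)) => // k; suff -> : k = i by exact: ltnW.
by apply: val_inj; have := ltn_ord k; have := ltn_ord i; move: n1; rewrite /=; lia.
Qed.

(** With at least three variables, for every [i] there is a coordinate [k] distinct from [i]
    and from the last one; an exchange between these two leaves coordinate [k] alone, so
    compression in direction [k] yields stability. *)
Lemma cl_step n : clements_lindstrom n.+2 -> clements_lindstrom n.+3.
Proof.
move=> cl a ab am d V0 sV0.
have [V [sV <- le comp]] := compressed_exists cl ab am sV0; apply: leq_trans le.
apply: cl_stable => //; last by move=> u v vV uB e; exact: (comp ord_max).
move=> i v w vV bw ni mv.
have [k ki kz] : exists2 k : 'I_n.+3, k != i & k != ord_max.
  have [->|i0] := eqVneq i ord0; last by exists ord0; rewrite // eq_sym.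
  have k1 : (inord 1 : 'I_n.+3) = 1 :> nat by rewrite inordK.
  by exists (inord 1); rewrite -(inj_eq val_inj) /= k1.
apply: (comp k w v vV).
- apply/boxP; split; first exact/in_boxP.
  by rewrite (deg_move mv); case/boxP: (subsetP sV _ vV).
- by have := mv k; rewrite (negPf ki) (negPf kz) !addn0.
apply/lexP; exists i; first by have := mv i; rewrite eqxx (negPf ni) addn0 addn1 => ->.
move=> j ji; have := mv j.
have -> : (j == i) = false by apply/eqP=> e; rewrite e ltnn in ji.
have -> : (j == ord_max) = false; last by rewrite !addn0.
by apply/eqP=> e; move: ji; rewrite e /= ltnNge -ltnS ltn_ord.
Qed.

Lemma deg2 (v : vec 2) : deg v = v ord0 + v ord_max.
Proof. by rewrite /deg big_ord_recr big_ord1 /=; congr (v _ + _); apply: val_inj. Qed.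

Lemma ord2P (P : 'I_2 -> Prop) : P ord0 -> P ord_max -> forall i, P i.
Proof.
by move=> P0 P1 [[|[|//]] lt]; [have -> : Ordinal lt = ord0 by apply: val_inj
  | have -> : Ordinal lt = ord_max by apply: val_inj].
Qed.

Lemma box2_inj (a : 'I_2 -> nat) d (u v : vec 2) : u \in box B a d -> v \in box B a d ->
  u ord0 = v ord0 -> u = v.
Proof.
move=> /boxP[_]; rewrite deg2 => du /boxP[_]; rewrite deg2 => dv e.
by apply: vec_ext; apply: ord2P => //; move: du dv; rewrite e; lia.
Qed.

(** A level of a two-dimensional box is a chain.  Multiply the elements below a missing
    element [u] by the first variable and those above it by the second: the images do not
    collide thanks to the gap at [u], and neither product leaves the box. *)
Lemma card_shadow2 (a : 'I_2 -> nat) d (V : {set vec 2}) u :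
  (forall i, a i <= B.+1) -> V \subset box B a d -> u \in box B a d -> u \notin V ->
  #|V| <= #|shadow a V|.
Proof.
move=> ab sV uB uV.
pose f (v : vec 2) := if v ord0 < u ord0 then raise ord0 v else raise ord_max v.
have /boxP[bu] := uB; rewrite deg2 => du.
have fU v : v \in V ->
  f v \in shadow a V /\ f v ord0 = v ord0 + (v ord0 < u ord0).
  move=> vV; have vB := subsetP sV _ vV; have /boxP[bv] := vB; rewrite deg2 => dv.
  rewrite /f; case: ltngtP => [lt|lt|e].
  - have h : (v ord0).+1 < a ord0 by apply: leq_ltn_trans lt (bu _).
    by rewrite (raise_shadow ab sV) // (raiseE ab h) eqxx.
  - have h : (v ord_max).+1 < a ord_max.
      by apply: leq_ltn_trans (bu ord_max); move: du dv lt; lia.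
    by rewrite (raise_shadow ab sV) // (raiseE ab h).
  by rewrite (box2_inj vB uB e) (negPf uV) in vV.
rewrite -(card_in_imset (f := f)).
  by apply/subset_leq_card/subsetP=> _ /imsetP[v /fU[? _] ->].
move=> v w vV wV /(congr1 (fun x : vec 2 => x ord0)).
have [_ ->] := fU _ vV; have [_ ->] := fU _ wV => e.
apply: (box2_inj (subsetP sV _ vV) (subsetP sV _ wV)).
have neq x : x \in V -> x ord0 <> u ord0.
  by move=> xV /(box2_inj (subsetP sV _ xV) uB) ex; rewrite ex (negPf uV) in xV.
by move: e (neq _ vV) (neq _ wV); case: ltnP; case: ltnP; lia.
Qed.

(** When the box imposes no condition in degree [d.+1], multiplication by the first variable
    is injective and misses the product of the smallest element by the second one. *)
Lemma card_shadow2_free (a : 'I_2 -> nat) d (V : {set vec 2}) :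
  (forall i, a i <= B.+1) -> (forall i, d.+1 < a i) -> V \subset box B a d -> V != set0 ->
  #|V| < #|shadow a V|.
Proof.
move=> ab da sV /set0Pn[v0 v0V].
have [v vV vmin] := arg_minnP (fun v : vec 2 => v ord0) v0V.
have h i w : w \in V -> (w i).+1 < a i.
  move=> wV; apply: leq_ltn_trans (da i).
  have /boxP[_] := subsetP sV _ wV; rewrite deg2.
  by move: i; apply: ord2P; lia.
have incj : {in V &, injective (raise (B := B) (ord0 : 'I_2))}.
  move=> u w uV wV /(congr1 (fun x : vec 2 => x ord0)).
  rewrite !(raiseE ab (h _ _ _)) // => /addIn; exact: box2_inj (subsetP sV _ uV) (subsetP sV _ wV).
rewrite -(card_in_imset incj); apply: proper_card; apply/properP; split.
  by apply/subsetP=> _ /imsetP[w wV ->]; exact: raise_shadow ab sV wV (h _ _ wV).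
exists (raise ord_max v); first exact: raise_shadow ab sV vV (h _ _ vV).
apply/imsetP=> -[w wV /(congr1 (fun x : vec 2 => x ord0))].
rewrite !(raiseE ab (h _ _ _)) //= addn0 addn1 => e; have := vmin _ wV.
by rewrite e ltnn.
Qed.

(** The part of the shadow of the segment divisible by the last variable has at most [#|V|]
    elements, and at most one element, a power of the first variable, is left.  If this
    power lies in the box then, since the first bound is the smaller one, the box imposes
    no condition in this degree. *)
Lemma cl_two_variables : clements_lindstrom 2.
Proof.
move=> a ab am d V sV.
have [->|neqV] := eqVneq V (box B a d).
  by rewrite lseg_upclosedE.
have [u uB uV] : exists2 u, u \in box B a d & u \notin V.
  apply/subsetPn; apply: contra neqV => s; by rewrite eqEsubset sV.
have cV : #|V| < #|box B a d| by apply: proper_card; apply/properP; split=> //; exists u.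
have cL := card_lseg (ltnW cV); set L := lseg B a d #|V|; rewrite -/L in cL.
have sL : L \subset box B a d := lseg_sub _ _ _ _.
have uL : upclosed (box B a d) L := @lseg_upclosed _ _ _ _ _.
clearbody L.
have pos : #|[set w in shadow a L | 0 < w ord_max]| <= #|V|.
  apply: leq_trans (card_shadow_lseg_pos sL uL) _.
  by rewrite -cL; apply/subset_leq_card/subsetP=> v; rewrite inE => /andP[].
have splitL : #|shadow a L| = #|[set w in shadow a L | w ord_max == 0]| + #|[set w in shadow a L | 0 < w ord_max]|.
  rewrite -(cardsID [set w : vec 2 | w ord_max == 0] (shadow a L)); congr (_ + _);
    apply: eq_card => w; rewrite !inE // lt0n // andbC //.
have [e0|[w]] := set_0Vmem [set w in shadow a L | w ord_max == 0].
  by rewrite splitL e0 cards0 add0n; apply: leq_trans pos (card_shadow2 ab sV uB uV).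
rewrite inE => /andP[wU w0].
have /boxP[bw dw] := subsetP (shadow_sub_box sL) _ wU.
have da i : d.+1 < a i.
  apply: leq_trans (am ord0 i isT); rewrite -dw deg2 (eqP w0) addn0; exact: bw.
have V0 : V != set0.
  apply: contraTneq wU => V0; move: cL; rewrite V0 cards0 => /eqP; rewrite cards_eq0 => /eqP ->.
  by rewrite shadow0 inE.
apply: leq_trans (card_shadow2_free ab da sV V0); rewrite splitL -[leqRHS]add1n leq_add //.
rewrite -[leqRHS](cards1 w); apply/subset_leq_card/subsetP=> v; rewrite !inE -!andbA.
move=> /and3P[bv ex v0]; apply/eqP/(@box2_inj a d.+1).
- by apply: (subsetP (shadow_sub_box sL)); rewrite inE bv.
- exact: (subsetP (shadow_sub_box sL)).
have : v \in shadow a L by rewrite inE bv.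
move/(subsetP (shadow_sub_box sL))/boxP=> [_]; rewrite -dw !deg2 (eqP v0) (eqP w0) !addn0; exact.
Qed.

Theorem clements_lindstrom_all n : clements_lindstrom n.
Proof.
case: n => [|[|n]]; [exact: cl_few_variables|exact: cl_few_variables|].
elim: n => [|n IH]; [exact: cl_two_variables|exact: cl_step].
Qed.

Definition growth n (a : 'I_n -> nat) d s := #|shadow a (lseg B a d s)|.

Lemma card_box_slices n (a : 'I_n.+1 -> nat) d : a ord_max <= B.+1 ->
  #|box B a d| = \sum_(j < a ord_max | j <= d) #|box B (del_bound ord_max a) (d - j)|.
Proof.
move=> ab; rewrite (big_ord_widen_cond _ (fun j => j <= d)
  (fun j => #|box B (del_bound ord_max a) (d - j)|) ab) (card_slices ord_max) [RHS]big_mkcond.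
apply: eq_bigr => j _; rewrite slice_box andbC; by case: ifP => // _; rewrite cards0.
Qed.

(** The numerical form in which the theorem is used: the sizes [c] of segments in the slices
    and bounds [g] for the slices of the shadow determine a bound for the growth of a
    segment with [\sum c] elements. *)
Lemma growth_slices n (a : 'I_n.+1 -> nat) d (c g : nat -> nat) :
  (forall i, a i <= B.+1) -> (forall i j : 'I_n.+1, i <= j -> a i <= a j) ->
  (forall j, j < a ord_max -> j <= d -> c j <= #|box B (del_bound ord_max a) (d - j)|) ->
  (forall j, j < a ord_max -> j <= d -> growth (del_bound ord_max a) (d - j) (c j) <= g j) ->
  (forall j, j.+1 < a ord_max -> j <= d -> c j <= g j.+1) ->
  growth a d (\sum_(j < a ord_max | j <= d) c j) <= \sum_(j < a ord_max | j <= d.+1) g j.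
Proof.
move=> ab am c0 g1 g2.
pose c' (j : 'I_B.+1) := if (j <= d) && (j < a ord_max) then c j else 0.
pose V := stack a d ord_max c'.
have cs j : #|slice ord_max j V| = c' j.
  apply: card_slice_stack; rewrite slice_box /c' andbC; case: ifP => // /andP[ja jd].
  exact: c0.
rewrite (big_ord_widen_cond _ (fun j => j <= d) c (ab _)).
rewrite (big_ord_widen_cond _ (fun j => j <= d.+1) g (ab _)).
rewrite big_mkcond [leqRHS]big_mkcond /=.
have <- : #|V| = \sum_(j < B.+1) c' j.
  by rewrite (card_slices ord_max); apply: eq_bigr => j _; exact: cs.
apply: leq_trans (clements_lindstrom_all ab am (stack_sub _ _ _ _)) _.
rewrite (card_slices ord_max); apply: leq_sum => j _.
apply: leq_trans (card_slice_shadow_stack (g := fun j : 'I_B.+1 => if j <= d.+1 then g j else 0) _ _ j) _.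
- move=> {}j ja; case: (leqP j d) => jd; last first.
    by rewrite slice_stack slice_box [j <= d]leqNgt jd andbF (_ : seg _ _ _ = set0) ?shadow0 ?cards0 //;
       apply/eqP; rewrite -subset0 seg_sub.
  rewrite leqW // slice_stack slice_box ja jd /c' jd ja; exact: g1.
- move=> {}j j' ja jj; rewrite cs /c'; case: ifP => // /andP[jd _].
  by rewrite -jj ltnS jd; apply: g2 => //; rewrite jj.
by rewrite if_and; case: ifP; case: ifP.
Qed.

End ClementsLindstrom.


Local Open Scope ring_scope.

(** * Hilbert functions of homogeneous ideals *)

Section Ideals.
Variables (k : fieldType) (N : nat).
Local Notation S := {mpoly k[N.+1]}.
Local Notation form t := (dhomog N.+1 k t).
Local Notation hpart := (pihomog mdeg).

Lemma hpartM (g : S) e d q : g \is e.-homog ->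
  hpart d (q * g) = if (e <= d)%N then hpart (d - e) q * g else 0.
Proof.
move=> gh; pose K := maxn (msize q) d.+1.
rewrite {1}(@pihomog_partitionE _ _ mdeg K q) ?leq_maxl // mulr_suml raddf_sum /=.
have hj j : hpart d (hpart j q * g) = if (j + e == d)%N then hpart j q * g else 0.
  have h : hpart j q * g \is (j + e).-homog by apply: dhomogM => //; exact: pihomogP.
  case: eqP => [<-|/eqP ne]; first exact: pihomog_dE.
  exact: pihomog_ne0 h.
rewrite (eq_bigr _ (fun (j : 'I_K) _ => hj j)); case: leqP => ed.
  have lt : (d - e < K)%N by rewrite leq_max ltnS leq_subr orbT.
  rewrite (bigD1 (Ordinal lt)) //= subnK // eqxx big1 ?addr0 // => j nj.
  case: eqP => // e'; case/eqP: nj; apply: val_inj => /=; lia.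
by rewrite big1 // => j _; case: eqP => // e'; lia.
Qed.

(** Membership predicates of ideals closed under taking homogeneous components.  The unit
    ideal is included, since colon ideals may reach it. *)
Record hom_ideal (K : S -> Prop) : Prop := HomIdeal {
  hom_ideal0 : K 0;
  hom_idealD : forall p q, K p -> K q -> K (p + q);
  hom_idealM : forall p q, K p -> K (q * p);
  hom_ideal_part : forall p d, K p -> K (hpart d p) }.

Lemma hom_idealZ K c p : hom_ideal K -> K p -> K (c *: p).
Proof. by move=> hK Kp; rewrite -mul_mpolyC; exact: hom_idealM. Qed.

Lemma hom_ideal_sum K I (r : seq I) (P : pred I) F : hom_ideal K ->
  (forall i, P i -> K (F i)) -> K (\sum_(i <- r | P i) F i).
Proof. by move=> hK h; apply: (big_ind K) => //; [exact: hom_ideal0|exact: hom_idealD]. Qed.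

(** Enlarge a subspace contained in [P] as long as some vector of [P] is missing; the
    dimension bounds the number of steps. *)
Lemma vspace_of (V : vectType k) (P : V -> Prop) :
  P 0 -> (forall c u v, P u -> P v -> P (c *: u + v)) ->
  exists U : {vspace V}, forall v, v \in U <-> P v.
Proof.
move=> P0 Pl.
suff grow m (U : {vspace V}) : (\dim {:V} - \dim U < m)%N -> (forall v, v \in U -> P v) ->
    exists U : {vspace V}, forall v, v \in U <-> P v.
  by apply: (grow _ 0%VS (ltnSn _)) => v; rewrite memv0 => /eqP ->.
elim: m U => // m IH U ltm UP.
case: (classic (forall v, P v -> v \in U)) => [h|nall].
  by exists U => v; split; [exact: UP|exact: h].
have [v nv] := not_all_ex_not _ _ nall; have [Pv /negP vU] := imply_to_and _ _ nv.
apply: (IH (U + <[v]>)%VS).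
  suff lt : (\dim U < \dim (U + <[v]>))%N.
    by have := dimvS (subvf (U + <[v]>)); move: ltm lt; lia.
  rewrite ltn_neqAle dimvS ?addvSl // andbT; apply: contra vU => /eqP e.
  have /eqP -> : U == (U + <[v]>)%VS by rewrite eqEdim addvSl e leqnn.
  by apply: (subvP (addvSr U <[v]>)); exact: memv_line.
move=> _ /memv_addP[u uU [_ /vlineP[c ->] ->]].
by rewrite addrC; apply: Pl => //; exact: UP.
Qed.

(** The dimension count of the exact sequence
    0 -> V / f^-1(U) -> W / U -> W / (U + f(V)) -> 0. *)
Lemma codim_exact (V W : vectType k) (f : 'Hom(V, W)) (U : {vspace W}) :
  (\dim {:W} - \dim (U + limg f) + (\dim {:V} - \dim (f @^-1: U)) = \dim {:W} - \dim U)%N.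
Proof.
have e1 := dimv_sum_cap U (limg f).
have e2 := limg_ker_dim f fullv; rewrite capfv in e2.
have e3 := limg_ker_dim f (f @^-1: U)%VS.
have ker : (lker f <= f @^-1: U)%VS.
  by apply/subvP=> v; rewrite memv_ker -memv_preim => /eqP ->; exact: mem0v.
rewrite (capv_idPr ker) -lpreim_cap_limg lpreimK ?capvSr // in e3.
rewrite -lpreim_cap_limg.
have := dimvS (subvf (U + limg f)); have := dimvS (capvSr U (limg f)).
by move: e1 e2 e3; lia.
Qed.

Definition piece (K : S -> Prop) t : {vspace form t} :=
  epsilon (inhabits 0%VS) (fun U => forall v : form t, v \in U <-> K (val v)).

Lemma pieceP K t v : hom_ideal K -> (v \in piece K t) <-> K (val v).
Proof.
move=> hK; move: v; rewrite /piece.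
apply: (epsilon_spec (inhabits 0%VS) (fun U => forall v : form t, v \in U <-> K (val v))).
apply: vspace_of; first exact: hom_ideal0.
by move=> c u v Ku Kv; rewrite linearP; apply: hom_idealD => //; exact: hom_idealZ.
Qed.

Definition hilb K t := (\dim {: form t} - \dim (piece K t))%N.

Lemma dim_form t : \dim {: form t} = 'C(t + N, t).
Proof. by rewrite dimvf. Qed.

Lemma dim_piece_hilb K t : (hilb K t + \dim (piece K t) = \dim {: form t})%N.
Proof. by rewrite subnK // dimvS // subvf. Qed.

Lemma hilb_le (K K' : S -> Prop) t : hom_ideal K -> hom_ideal K' ->
  (forall p, p \is t.-homog -> K p -> K' p) -> (hilb K' t <= hilb K t)%N.
Proof.
move=> hK hK' s; apply: leq_sub2l; apply: dimvS; apply/subvP=> v.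
by move/(pieceP _ hK) => Kv; apply/(pieceP _ hK'); exact: (s _ (dhomog_is_dhomog v) Kv).
Qed.

Lemma hilb_eq (K K' : S -> Prop) t : hom_ideal K -> hom_ideal K' ->
  (forall p, p \is t.-homog -> K p <-> K' p) -> hilb K t = hilb K' t.
Proof.
by move=> hK hK' s; apply/eqP; rewrite eqn_leq !hilb_le // => p /s h /h.
Qed.

Lemma hilb_full (K : S -> Prop) t : hom_ideal K ->
  (forall p, p \is t.-homog -> K p) -> hilb K t = 0%N.
Proof.
move=> hK h; apply/eqP; rewrite subn_eq0; apply: dimvS; apply/subvP=> v _.
by apply/(pieceP _ hK); exact: (h _ (dhomog_is_dhomog v)).
Qed.

Lemma hilb0_full (K : S -> Prop) t : hom_ideal K -> hilb K t = 0%N ->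
  forall p, p \is t.-homog -> K p.
Proof.
move=> hK h0 p ph.
have e : piece K t = fullv by apply/eqP; rewrite eqEdim subvf -(dim_piece_hilb K) h0 leqnn.
by apply/(pieceP (DHomog ph) hK); rewrite e memvf.
Qed.

Definition colon (K : S -> Prop) g p := K (p * g).
Definition adjoin (K : S -> Prop) g p := exists q, K (p - q * g).

Lemma colon_hom_ideal K g e : hom_ideal K -> g \is e.-homog -> hom_ideal (colon K g).
Proof.
move=> hK gh; split.
- by rewrite /colon mul0r; exact: hom_ideal0.
- by move=> p q Kp Kq; rewrite /colon mulrDl; exact: hom_idealD.
- by move=> p q Kp; rewrite /colon -mulrA; exact: hom_idealM.
move=> p d Kp; have := hom_ideal_part hK (e + d) Kp.
by rewrite (hpartM _ _ gh) leq_addr addKn.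
Qed.

Lemma adjoin_hom_ideal K g e : hom_ideal K -> g \is e.-homog -> hom_ideal (adjoin K g).
Proof.
move=> hK gh; split.
- by exists 0; rewrite mul0r subr0; exact: hom_ideal0.
- move=> p q [p' Kp] [q' Kq]; exists (p' + q').
  by rewrite mulrDl opprD addrACA; exact: hom_idealD.
- by move=> p q [p' Kp]; exists (q * p'); rewrite -mulrA -mulrBr; exact: hom_idealM.
move=> p d [q Kp]; have := hom_ideal_part hK d Kp.
rewrite linearB /= (hpartM _ _ gh); case: leqP => _ h; first by exists (hpart (d - e) q).
by exists 0; rewrite mul0r.
Qed.

Lemma adjoin_sub (K : S -> Prop) g p : K p -> adjoin K g p.
Proof. by exists 0; rewrite mul0r subr0. Qed.

Lemma adjoin_gen (K : S -> Prop) g : hom_ideal K -> adjoin K g g.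
Proof. by exists 1; rewrite mul1r subrr; exact: hom_ideal0. Qed.

Section Multiplication.
Variables (g : S) (e : nat) (gh : g \is e.-homog) (t : nat).
Definition mulform (v : form t) : form (e + t) := DHomog (dhomogM gh (dhomog_is_dhomog v)).
Lemma mulform_linear : linear mulform.
Proof. by move=> c u v; apply: val_inj; rewrite /= mulrDr scalerAr. Qed.
HB.instance Definition _ :=
  GRing.isLinear.Build k (form t) (form (e + t)) _ mulform mulform_linear.
End Multiplication.

(** The exact sequence 0 -> S/(K : g)(-e) -> S/K -> S/(K + (g)) -> 0. *)
Lemma hilb_exact K g e t : hom_ideal K -> g \is e.-homog ->
  (hilb (adjoin K g) (e + t) + hilb (colon K g) t = hilb K (e + t))%N.
Proof.
move=> hK gh; pose f := linfun (mulform gh (t := t)).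
have fE v : val (f v) = g * val v by rewrite lfunE.
set U := piece K (e + t).
have pa : piece (adjoin K g) (e + t) = (U + limg f)%VS.
  apply/vspaceP=> v; apply/idP/idP.
    move/(pieceP _ (adjoin_hom_ideal hK gh)) => [q /(hom_ideal_part hK (e + t))].
    rewrite linearB /= (hpartM _ _ gh) leq_addr addKn.
    rewrite (pihomog_dE (dhomog_is_dhomog v)) => Kv.
    pose w : form t := DHomog (pihomogP mdeg t q).
    rewrite -[v](subrK (f w)) memv_add ?memv_img ?memvf //.
    by apply/(pieceP _ hK); rewrite linearB /= fE /= mulrC.
  move/memv_addP => [u /(pieceP _ hK) Ku [_ /memv_imgP[w _ ->] ->]].
  apply/(pieceP _ (adjoin_hom_ideal hK gh)); exists (val w).
  by rewrite linearD /= fE mulrC addrK.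
have pc : piece (colon K g) t = (f @^-1: U)%VS.
  apply/vspaceP=> v; rewrite -memv_preim; apply/idP/idP.
    by move/(pieceP _ (colon_hom_ideal hK gh)) => Kv; apply/(pieceP _ hK); rewrite fE mulrC.
  by move/(pieceP _ hK); rewrite fE mulrC => Kv; apply/(pieceP _ (colon_hom_ideal hK gh)).
by rewrite /hilb pa pc; exact: codim_exact.
Qed.

Lemma hilb_low K g e t : hom_ideal K -> g \is e.-homog -> (t < e)%N ->
  hilb (adjoin K g) t = hilb K t.
Proof.
move=> hK gh lt; apply: hilb_eq => //; first exact: adjoin_hom_ideal gh.
move=> p ph; split; last exact: adjoin_sub.
move=> [q /(hom_ideal_part hK t)]; rewrite linearB /= (hpartM _ _ gh) leqNgt lt subr0.
by rewrite pihomog_dE.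
Qed.

(** Filter [S/K] by successive colons with the linear forms in [s].  In the degree at hand,
    always split off the form [l] for which [S/(K + (l))] is largest.  The next quotient is
    by an ideal containing [K + (l')] for some [l'] that was also available, hence it is
    not larger in that degree; the degree of interest then drops by one. *)
Lemma greedy_filtration r : forall (K : S -> Prop) (s : seq S) d, hom_ideal K -> size s = r ->
  (forall l, l \in s -> l \is 1.-homog) -> K (\prod_(l <- s) l) ->
  exists E : nat -> S -> Prop,
  [/\ forall j, (j < r)%N -> hom_ideal (E j) /\
        exists2 l, l \in s & forall p, adjoin K l p -> E j p,
      forall t, hilb K t = (\sum_(j < r | j <= t) hilb (E j) (t - j))%N
    & forall j, (j.+1 < r)%N -> (j <= d)%N -> (hilb (E j.+1) (d - j) <= hilb (E j) (d - j))%N].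
Proof.
elim: r => [|r IH] K s d hK ss sh Ks.
  exists (fun _ => K); split=> // t; rewrite big_pred0; last by case.
  have K1 : K 1 by move: Ks; rewrite (size0nil ss) big_nil.
  by apply: hilb_full => // p _; rewrite -[p]mulr1; exact: hom_idealM.
have [l ls lmax] : exists2 l, l \in s &
    forall l', l' \in s -> (hilb (adjoin K l') d <= hilb (adjoin K l) d)%N.
  have i0 : 'I_(size s) by rewrite ss; exact: ord0.
  have [i _ imax] := @arg_maxnP _ i0 xpredT (fun i : 'I_(size s) => hilb (adjoin K s`_i) d) isT.
  exists s`_i; first exact: mem_nth.
  by move=> l' /(nthP 0)[j lj <-]; exact: (imax (Ordinal lj)).
have lh := sh _ ls.
have cK := colon_hom_ideal hK lh; have aK := adjoin_hom_ideal hK lh.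
have sr : size (rem l s) = r by rewrite size_rem // ss.
have rs l' : l' \in rem l s -> l' \in s by exact: mem_rem.
have Kr : colon K l (\prod_(l' <- rem l s) l').
  by rewrite /colon mulrC; move: Ks; rewrite (big_rem l) //=.
have [E [E1 E2 E3]] := IH _ _ d.-1 cK sr (fun l' h => sh _ (rs _ h)) Kr.
have sub l' p : adjoin K l' p -> adjoin (colon K l) l' p.
  by move=> [q Kq]; exists q; rewrite /colon mulrC; exact: hom_idealM.
exists (fun j => if j is j'.+1 then E j' else adjoin K l); split.
- case=> [|j] lt; first by split=> //; exists l.
  have [hE [l' l's h]] := E1 _ lt; split=> //; exists l'; first exact: rs.
  by move=> p /sub /h.
- move=> [|t].
    rewrite big_mkcond big_ord_recl big1 //= addn0.
    by rewrite (hilb_low hK lh).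
  rewrite -add1n -(hilb_exact t hK lh) E2 add1n big_mkcond [RHS]big_mkcond /=.
  by rewrite [RHS]big_ord_recl /=.
case=> [|j] lt jd.
  rewrite !subn0; have [hE [l' l's h]] := E1 0%N lt.
  have l's' := rs _ l's.
  apply: leq_trans (lmax _ l's'); apply: hilb_le => //.
    exact: adjoin_hom_ideal (sh _ l's').
  by move=> p _ /sub /h.
have -> : (d - j.+1 = d.-1 - j)%N by lia.
by apply: E3 => //; lia.
Qed.

End Ideals.

(** * Growth of Hilbert functions in the presence of split forms *)

Section Growth.
Variables (k : fieldType) (N : nat).
Local Notation S := {mpoly k[N.+1]}.
Variable B : nat.

Lemma all_variables_in (K : S -> Prop) : hom_ideal K -> (forall x : 'I_N.+1, K 'X_x) ->
  forall t p, p \is t.+1.-homog -> K p.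
Proof.
move=> hK KX t p ph; rewrite [p]mpolyE big_seq; apply: hom_ideal_sum => // m mp.
have dm : mdeg m = t.+1 by exact: (dhomog_mf ph).
have [x mx] : exists x, m x != 0%N.
  apply/existsP; rewrite -negb_forall; apply: contra_eqN dm => /forallP m0.
  by rewrite mdegE big1 // => i _; apply/eqP.
apply: hom_idealZ => //; have -> : m = (m - U_(x) + U_(x))%MM by rewrite submK // lep1mP.
by rewrite mpolyXD; exact: hom_idealM.
Qed.

(** Induction on the number of split forms.  The transversal hypothesis passes to the ideals [E j] of [greedy_filtration], which
    contain a form [l] of the last list: a transversal of the remaining lists is completed
    by [l]. *)
Lemma hilb_growth m : forall (a : 'I_m -> nat) (L : 'I_m -> seq S) (K : S -> Prop),
  (forall i, a i <= B.+1)%N -> (forall i j : 'I_m, i <= j -> a i <= a j)%N ->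
  (forall i, size (L i) = a i) ->
  (forall i l, l \in L i -> l \is 1.-homog) ->
  hom_ideal K -> (forall i, K (\prod_(l <- L i) l)) ->
  (forall c : 'I_m -> S, (forall i, c i \in L i) ->
     forall x : 'I_N.+1, exists q : 'I_m -> S, K ('X_x - \sum_i q i * c i)) ->
  forall t, (hilb K t <= #|box B a t|)%N /\
    (hilb K t.+1 + growth B a t (#|box B a t| - hilb K t) <= #|box B a t.+1|)%N.
Proof.
elim: m => [|m IH] a L K ab am La Lh hK KL KT t.
  have KX x : K 'X_x.
    by have [|q] := KT (fun=> 0) _ x; [case|rewrite big_ord0 subr0].
  have h0 t' : hilb K t'.+1 = 0%N.
    by apply: hilb_full => // p; exact: all_variables_in.
  rewrite h0; split; last by apply: subset_leq_card; apply: shadow_sub_box; exact: lseg_sub.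
  case: t => [|t]; last by rewrite h0.
  apply: (@leq_trans 1).
    by apply: leq_trans (leq_subr _ _) _; rewrite dim_form bin0.
  rewrite card_gt0; apply/set0Pn; exists (mkvec B (fun=> 0%N)).
  by apply/boxP; split; [case|rewrite /deg big_ord0].
have [E [E1 E2 E3]] := greedy_filtration t hK (La ord_max) (@Lh ord_max) (KL ord_max).
pose a' := del_bound ord_max a; pose bx := fun t => #|box B a' t|.
have IH' j : (j < a ord_max)%N -> forall t, (hilb (E j) t <= bx t)%N /\
    (hilb (E j) t.+1 + growth B a' t (bx t - hilb (E j) t) <= bx t.+1)%N.
  move=> ja; have [hE [l lL sE]] := E1 _ ja.
  apply: (IH a' (fun i => L (lift ord_max i))) => //.
  - by move=> i; exact: ab.
  - exact: del_bound_mono.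
  - by move=> i l' /Lh.
  - by move=> i; apply/sE/adjoin_sub.
  move=> c cL x; pose c' i := if unlift ord_max i is Some i' then c i' else l.
  have [|q Kq] := KT c' _ x.
    by apply: (@lift_forall _ ord_max) => [|i]; rewrite /c' ?unlift_none ?liftK.
  exists (fun i => q (lift ord_max i)); apply: sE; exists (q ord_max).
  move: Kq; rewrite (bigD1_ord ord_max) //= [in c' ord_max]/c' unlift_none opprD addrA addrAC.
  by congr (K (_ - _ - _)); apply: eq_bigr => i _; rewrite /c' liftK.
have bE t' : #|box B a t'| = (\sum_(j < a ord_max | j <= t') bx (t' - j))%N.
  by rewrite (card_box_slices _ (ab _)).
have le t' : (hilb K t' <= #|box B a t'|)%N.
  by rewrite E2 bE; apply: leq_sum => j _; case: (IH' j (ltn_ord j) (t' - j)%N).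
split=> //; rewrite -leq_subRL ?le //.
pose c j := (bx (t - j) - hilb (E j) (t - j))%N.
pose g j := (bx (t.+1 - j) - hilb (E j) (t.+1 - j))%N.
have hE j t' (ja : (j < a ord_max)%N) : (hilb (E j) t' <= bx t')%N by case: (IH' j ja t').
have -> : (#|box B a t| - hilb K t = \sum_(j < a ord_max | j <= t) c j)%N.
  by rewrite sumnB ?bE ?E2 // => j _; exact: hE.
have -> : (#|box B a t.+1| - hilb K t.+1 = \sum_(j < a ord_max | j <= t.+1) g j)%N.
  by rewrite sumnB ?bE ?E2 // => j _; exact: hE.
apply: growth_slices => // j ja jt; first exact: leq_subr.
  have [_] := IH' j ja (t - j)%N; rewrite /g subSn // leq_subRL //; exact: hE.
by rewrite /c /g subSS; apply: leq_sub2l; exact: E3.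
Qed.

End Growth.

(** * Iterated differences *)

Section Differences.
Implicit Types (u v : nat -> int).

Definition diff u t := u t.+1 - u t.

(** The [m]-th difference is eventually zero, that is, [u] eventually agrees with a
    polynomial of degree less than [m]. *)
Fixpoint diff_vanishes m u : Prop :=
  if m is m'.+1 then diff_vanishes m' (diff u)
  else exists T, forall t, (T <= t)%N -> u t = 0.

Lemma diff_vanishes_ext m u v : (forall t, u t = v t) -> diff_vanishes m u -> diff_vanishes m v.
Proof.
elim: m u v => [|m IH] u v e /=; last by apply: IH => t; rewrite /diff !e.
by move=> [T h]; exists T => t /h; rewrite e.
Qed.

Lemma diff_vanishes0 m : diff_vanishes m (fun=> 0).
Proof.
elim: m => [|m IH] /=; first by exists 0%N.
by apply: diff_vanishes_ext IH => t; rewrite /diff subrr.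
Qed.

Lemma diff_vanishesD m u v : diff_vanishes m u -> diff_vanishes m v ->
  diff_vanishes m (fun t => u t + v t).
Proof.
elim: m u v => [|m IH] u v /=.
  move=> [T h] [T' h']; exists (maxn T T') => t; rewrite geq_max => /andP[? ?].
  by rewrite h ?h' ?addr0.
move=> hu hv; apply: diff_vanishes_ext (IH _ _ hu hv) => t.
by rewrite /diff; ring.
Qed.

Lemma diff_vanishes_shift m u a : diff_vanishes m u <-> diff_vanishes m (fun t => u (t + a)%N).
Proof.
elim: m u => [|m IH] u /=; last exact: IH.
split=> -[T h]; first by exists T => t le; apply: h; apply: leq_trans le (leq_addr _ _).
exists (T + a)%N => t le; rewrite -(subnK (leq_trans (leq_addl _ _) le)); apply: h.
by rewrite leq_subRL ?(leq_trans (leq_addl _ _) le) // addnC.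
Qed.

(** A difference with step [a] is a sum of [a] shifted unit differences. *)
Lemma diff_vanishes_step m u a : diff_vanishes m.+1 u ->
  diff_vanishes m (fun t => u (t + a)%N - u t).
Proof.
move=> hu; elim: a => [|a IH].
  by apply: diff_vanishes_ext (diff_vanishes0 m) => t; rewrite addn0 subrr.
have := diff_vanishesD (iffLR (diff_vanishes_shift m (diff u) a) hu) IH.
by apply: diff_vanishes_ext => t; rewrite /diff addnS; ring.
Qed.

Lemma diff_vanishes_binomial m : diff_vanishes m.+1 (fun t => 'C(t + m, m)%:Z).
Proof.
elim: m => [|m IH].
  by exists 0%N => t _; rewrite /diff !bin0 subrr.
have := iffLR (diff_vanishes_shift m.+1 _ 1) IH.
apply: (@diff_vanishes_ext m.+1) => t.
rewrite /diff (_ : t.+1 + m.+1 = (t + 1 + m).+1)%N; last by lia.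
rewrite (_ : t + m.+1 = t + 1 + m)%N; last by lia.
by rewrite binS PoszD; ring.
Qed.

End Differences.

(** * Ideals generated by homogeneous elements *)

Section GeneratedIdeals.
Variables (k : fieldType) (N : nat).
Local Notation S := {mpoly k[N.+1]}.
Implicit Types (G K : S -> Prop).

Lemma gen_ideal_min G K : K 0 -> (forall p q, K p -> K q -> K (p + q)) ->
  (forall p q, K p -> K (q * p)) -> (forall g, G g -> K g) ->
  forall p, gen_ideal G p -> K p.
Proof.
move=> K0 KD KM GK p [r [c [g [Gg ->]]]]; apply: (big_ind K) => // j _.
exact/KM/GK.
Qed.

Lemma gen_ideal_gen G g : G g -> gen_ideal G g.
Proof.
by move=> Gg; exists 1%N, (fun=> 1), (fun=> g); split=> //; rewrite big_ord1 mul1r.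
Qed.

Lemma gen_ideal_hom_ideal G : (forall g, G g -> exists d, g \is d.-homog) ->
  hom_ideal (gen_ideal G).
Proof.
move=> Gh.
have g0 : gen_ideal G 0.
  by exists 0%N, (fun=> 0), (fun=> 0); split=> [[]//|]; rewrite big_ord0.
have gD p q : gen_ideal G p -> gen_ideal G q -> gen_ideal G (p + q).
  move=> [r [c [g [Gg ->]]]] [r' [c' [g' [Gg' ->]]]].
  pose pick T (x : 'I_r -> T) (x' : 'I_r' -> T) (i : 'I_(r + r')) :=
    match split i with inl j => x j | inr j => x' j end.
  exists (r + r')%N, (pick _ c c'), (pick _ g g'); split.
    by move=> i; rewrite /pick; case: split.
  rewrite big_split_ord /=; congr (_ + _); apply: eq_bigr => i _.
    by rewrite /pick (unsplitK (inl i)).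
  by rewrite /pick (unsplitK (inr i)).
have gM p q : gen_ideal G p -> gen_ideal G (q * p).
  move=> [r [c [g [Gg ->]]]]; exists r, (fun j => q * c j), g; split=> //.
  by rewrite mulr_sumr; apply: eq_bigr => j _; rewrite mulrA.
split=> // p d [r [c [g [Gg ->]]]]; rewrite raddf_sum /=; apply: (big_ind (gen_ideal G)) => // j _.
have [e ge] := Gh _ (Gg j); rewrite (hpartM _ _ ge); case: ifP => // _.
exact/gM/gen_ideal_gen.
Qed.

End GeneratedIdeals.

(** * Regular sequences of split forms *)

Section Regular.
Variables (k : fieldType) (N : nat).
Local Notation S := {mpoly k[N.+1]}.
Variables (a : 'I_N.+1 -> nat) (f : 'I_N.+1 -> S).
Hypothesis fh : forall i, f i \is (a i).-homog.
Hypothesis freg : regular_sequence f.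

Definition initial_ideal (i : nat) : S -> Prop :=
  gen_ideal (fun p => exists2 j : 'I_N.+1, (j < i)%N & p = f j).

Lemma initial_ideal_hom_ideal i : hom_ideal (initial_ideal i).
Proof. by apply: gen_ideal_hom_ideal => g [j _ ->]; exists (a j). Qed.

Lemma initial_idealS (i : 'I_N.+1) p : initial_ideal i.+1 p <-> adjoin (initial_ideal i) (f i) p.
Proof.
have hi := initial_ideal_hom_ideal i; have hS := initial_ideal_hom_ideal i.+1.
have hA := adjoin_hom_ideal hi (fh i); split.
  apply: gen_ideal_min; [exact: hom_ideal0|exact: hom_idealD|by move=> *; exact: hom_idealM|].
  move=> _ [j + ->]; rewrite ltnS leq_eqVlt => /orP[/eqP/val_inj ->|lt].
    exact: adjoin_gen.
  by apply: adjoin_sub; apply: gen_ideal_gen; exists j.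
move=> [q Kq]; rewrite -[p](subrK (q * f i)); apply: (hom_idealD hS).
  move: Kq; apply: gen_ideal_min; [exact: hom_ideal0|exact: hom_idealD|by move=> *; exact: hom_idealM|].
  by move=> _ [j lt ->]; apply: gen_ideal_gen; exists j; rewrite // ltnW.
by apply: (hom_idealM hS); apply: gen_ideal_gen; exists i.
Qed.

(** Regularity says that the colon ideal by the next form is the ideal itself. *)
Lemma hilb_initial_step (i : 'I_N.+1) t :
  (hilb (initial_ideal i.+1) (a i + t) + hilb (initial_ideal i) t =
   hilb (initial_ideal i) (a i + t))%N.
Proof.
have hi := initial_ideal_hom_ideal i; have hS := initial_ideal_hom_ideal i.+1.
rewrite -(hilb_exact t hi (fh i)); congr (_ + _)%N.
  by apply: hilb_eq => //; [exact: adjoin_hom_ideal (fh i)|move=> p _; exact: initial_idealS].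
apply: hilb_eq => //; first exact: colon_hom_ideal (fh i).
move=> p _; split; last by have [h _] := freg; exact: h.
by rewrite /colon mulrC; exact: hom_idealM.
Qed.

Lemma hilb_initial0 t : hilb (initial_ideal 0) t = 'C(t + N, N).
Proof.
rewrite /hilb dim_form -[RHS](bin_sub (leq_addl _ _)) addnK -[RHS]subn0; congr (_ - _)%N.
apply/eqP; rewrite dimv_eq0 -subv0; apply/subvP=> v.
move/(pieceP _ (initial_ideal_hom_ideal 0)) => v0; rewrite memv0; apply/eqP/val_inj.
move: v0; apply: (@gen_ideal_min _ _ _ (fun p => p = 0)) => //.
- by move=> p q -> ->; rewrite addr0.
- by move=> p q ->; rewrite mulr0.
by move=> g [].
Qed.

(** The Hilbert function of [S] is a polynomial of degree [N], and each form of the sequence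
    replaces it by a difference. *)
Lemma hilb_initial_vanishes i : (i <= N.+1)%N ->
  diff_vanishes (N.+1 - i) (fun t => (hilb (initial_ideal i) t)%:Z).
Proof.
elim: i => [|i IH] le.
  apply: diff_vanishes_ext (diff_vanishes_binomial N) => t.
  by rewrite hilb_initial0.
have := IH (ltnW le); rewrite -subnSK // => /(diff_vanishes_step (a (Ordinal le))) h.
apply/(diff_vanishes_shift _ _ (a (Ordinal le))); apply: diff_vanishes_ext h => t /=.
have := hilb_initial_step (Ordinal le) t; rewrite [(_ + t)%N]addnC /= => <-.
by rewrite PoszD addrK.
Qed.

Lemma regular_power_in : exists2 t, (0 < t)%N & forall p, p \is t.-homog -> initial_ideal N.+1 p.
Proof.
have := hilb_initial_vanishes (leqnn _); rewrite subnn => -[T h].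
exists T.+1 => //; apply: (hilb0_full (initial_ideal_hom_ideal _)).
by have := h _ (leqnSn T) => -[].
Qed.

(** Some power of each variable lies in the ideal. *)
Lemma regular_no_common_zero (x : 'I_N.+1 -> k) : (forall i, (f i).@[x] = 0) -> forall j, x j = 0.
Proof.
move=> fx j; have [t t0 ht] := regular_power_in.
have : initial_ideal N.+1 ('X_j ^+ t).
  by apply: ht; rewrite mpolyXn dhomogX /= mdegMn mdeg1 mul1n.
move/(@gen_ideal_min _ _ _ (fun p => p.@[x] = 0)) => h.
have : ('X_j ^+ t).@[x] = 0.
  apply: h; first exact: meval0.
  - by move=> p q p0 q0; rewrite mevalD p0 q0 addr0.
  - by move=> p q p0; rewrite mevalM p0 mulr0.
  by move=> _ [i _ ->].
by rewrite rmorphXn /= mevalXU => /eqP; rewrite expf_eq0 t0 => /eqP.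
Qed.

(** If the linear forms of a transversal were dependent, they would vanish at a nonzero
    point, and so would all the [f i]. *)
Lemma regular_transversal (L : 'I_N.+1 -> seq S) (c : 'I_N.+1 -> S) :
  (forall i, f i = \prod_(l <- L i) l) -> (forall i l, l \in L i -> l \is 1.-homog) ->
  (forall i, c i \in L i) ->
  forall x : 'I_N.+1, exists q : 'I_N.+1 -> S, 'X_x = \sum_i q i * c i.
Proof.
move=> fL Lh cL x.
pose M := \matrix_(i, j) (c i)@_(U_(j)) : 'M[k]_N.+1.
have cE i : c i = \sum_j M i j *: 'X_j.
  apply/mpolyP=> m; rewrite raddf_sum /=.
  have [/mdeg1P[j /eqP ->]|nm] := boolP (mdeg m == 1%N).
    rewrite (bigD1 j) //= mcoeffZ mcoeffX eqxx mulr1 mxE big1 ?addr0 // => i' ne.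
    rewrite mcoeffZ mcoeffX; case: eqP => [e|]; last by rewrite mulr0.
    by have := congr1 (fun m : 'X_{1..N.+1} => m j) e; rewrite !mnm1E eqxx (negPf ne).
  rewrite (dhomog_nemf_coeff (Lh i _ (cL i)) nm) big1 // => j _.
  rewrite mcoeffZ mcoeffX; case: eqP => [e|]; last by rewrite mulr0.
  by rewrite -e mdeg1 eqxx in nm.
have MU : M \in unitmx.
  rewrite unitmxE unitfE; apply/negP; rewrite -det_tr => /det0P[v nv vM].
  case/negP: nv; apply/eqP/rowP => j; rewrite mxE.
  apply: (@regular_no_common_zero (fun j => v 0 j)) => i.
  rewrite fL (big_rem _ (cL i)) /= mevalM cE.
  suff -> : (\sum_j M i j *: 'X_j).@[fun j => v 0 j] = 0 by rewrite mul0r.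
  rewrite raddf_sum /=; have /rowP/(_ i) := vM; rewrite !mxE => vMi; rewrite -[RHS]vMi.
  by apply: eq_bigr => l _; rewrite mevalZ mevalXU mulrC [M^T _ _]mxE.
exists (fun i => (invmx M x i)%:MP).
under eq_bigr => i _ do rewrite cE mulr_sumr.
rewrite exchange_big /=.
have e j : \sum_i (invmx M x i)%:MP * (M i j *: 'X_j) = (x == j)%:R *: 'X_j.
  have := mulVmx MU => /matrixP/(_ x j); rewrite !mxE => <-.
  by rewrite scaler_suml; apply: eq_bigr => i _; rewrite mul_mpolyC scalerA.
rewrite (eq_bigr _ (fun j _ => e j)) (bigD1 x) //= eqxx scale1r big1 ?addr0 // => j nj.
by rewrite eq_sym (negPf nj) scale0r.
Qed.

End Regular.

(** * Bases of quotients *)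

Section Quotients.
Variables (k : fieldType) (N : nat).
Local Notation S := {mpoly k[N.+1]}.

Lemma graded_ideal_hom_ideal (I : {pred S}) : graded_ideal I -> hom_ideal (fun p => p \in I).
Proof.
move=> [[I0 _ Il] [G [Gh GI]]]; have hG := gen_ideal_hom_ideal (fun g Gg => Gh g Gg).
split=> //.
- by move=> p q Ip Iq; rewrite -[p]mul1r; exact: Il.
- by move=> p q Ip; rewrite -[q * p]addr0; exact: Il.
by move=> p d /GI h; apply/GI; exact: hom_ideal_part.
Qed.

(** A basis of a complement of [I] in degree [t] does it. *)
Lemma dim_quotient_hilb (I : {pred S}) t : hom_ideal (fun p => p \in I) ->
  dim_quotient I t (hilb (fun p => p \in I) t).
Proof.
move=> hI; set K := fun p => p \in I; set U := piece K t.
have e : hilb K t = \dim (U^C)%VS.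
  by rewrite /hilb dimv_compl.
rewrite e; set X := vbasis (U^C)%VS.
have fX : basis_of (U^C)%VS X := vbasisP _.
have sumE (c : 'I_(\dim (U^C)%VS) -> k) :
    val (\sum_j c j *: X`_j) = \sum_j c j *: val X`_j.
  by rewrite raddf_sum.
exists (fun j => val X`_j); split.
- by move=> j; exact: dhomog_is_dhomog.
- move=> c; rewrite -sumE => /(pieceP _ hI) inU.
  have /freeP fr := basis_free fX; apply: fr.
  apply/eqP; rewrite -memv0 -(capv_compl U) memv_cap inU.
  by apply: memv_suml => j _; apply: memvZ; apply: vbasis_mem; rewrite mem_nth ?size_tuple.
move=> p ph; pose v : dhomog N.+1 k t := DHomog ph.
have : v \in (U + U^C)%VS by rewrite addv_complf memvf.
case/memv_addP => u uU [w wC vE].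
exists (fun j => coord X j w); rewrite -sumE -(coord_basis fX wC).
have -> : p - val w = val u by rewrite (_ : p = val v) // vE linearD addrK.
exact/(pieceP _ hI).
Qed.

End Quotients.

(** * The lex-plus-powers ideal with a given Hilbert function *)

Section MonomialIdeal.
Variables (k : fieldType) (N B : nat) (a : 'I_N.+1 -> nat) (h : nat -> nat).
Local Notation S := {mpoly k[N.+1]}.
Hypothesis aB : forall i, (a i <= B.+1)%N.
Hypothesis a_gt0 : forall i, (0 < a i)%N.
Hypothesis h0 : h 0 = 1%N.
Hypothesis hbox : forall t, (h t <= #|box B a t|)%N.
Hypothesis hgrowth : forall t,
  (h t.+1 + growth B a t (#|box B a t| - h t) <= #|box B a t.+1|)%N.

Let segment t := lseg B a t (#|box B a t| - h t).
Let expo (m : 'X_{1..N.+1}) : vec B N.+1 := mkvec B m.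

(** These monomials span the ideal; the ones outside the box are the multiples of some
    x_i^(a i). *)
Definition lpp_mnm (m : 'X_{1..N.+1}) :=
  [forall i, (m i < a i)%N] ==> (expo m \in segment (mdeg m)).

Definition lpp : {pred S} := [pred p : S | all lpp_mnm (msupp p)].

Lemma expoE (m : 'X_{1..N.+1}) i : (forall i, (m i < a i)%N) -> expo m i = m i.
Proof. by move=> ma; rewrite mkvecE // -ltnS (leq_trans (ma i)). Qed.

Lemma expo_box (m : 'X_{1..N.+1}) : (forall i, (m i < a i)%N) -> expo m \in box B a (mdeg m).
Proof.
move=> ma; apply/boxP; split; first by move=> i; rewrite expoE.
by rewrite mdegE; apply: eq_bigr => i _; rewrite expoE.
Qed.

Lemma shadow_segment t : shadow a (segment t) \subset segment t.+1.
Proof.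
have sL := lseg_sub B a t (#|box B a t| - h t).
have uU := shadow_upclosed sL (@lseg_upclosed _ _ _ _ _).
rewrite (upclosedE (shadow_sub_box sL) uU); apply: seg_le.
by have := hgrowth t; rewrite -leq_subRL.
Qed.

(** This is where the growth condition [hgrowth] enters, through [shadow_segment]. *)
Lemma lpp_mnmU m i : lpp_mnm m -> lpp_mnm (m + U_(i))%MM.
Proof.
move=> /implyP lm; apply/implyP=> /forallP b'.
have mE j : (m + U_(i))%MM j = (m j + (j == i))%N by rewrite mnmDE mnm1E eq_sym.
have b j : (m j < a j)%N by apply: leq_ltn_trans (b' j); rewrite mE leq_addr.
have lm' := lm (introT forallP b).
rewrite mdegD mdeg1 addn1; apply: (subsetP (shadow_segment _)); apply/shadowP; split.
  by apply/in_boxP=> j; rewrite expoE.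
by exists (expo m) => //; exists i; apply/coversP=> j; rewrite !expoE.
Qed.

Lemma lpp_mnmD m m' : lpp_mnm m -> lpp_mnm (m' + m)%MM.
Proof.
have [d] := ubnP (mdeg m'); elim: d m' => // d IH m' ltd lm.
have [->|nz] := eqVneq m' 0%MM; first by rewrite add0m.
have [i mi] : exists i, m' i != 0%N.
  apply/existsP; rewrite -negb_forall; apply: contra nz => /forallP z.
  by apply/eqP/mnmP=> i; rewrite mnm0E; exact/eqP.
have e : m' = (m' - U_(i) + U_(i))%MM by rewrite submK // lep1mP.
rewrite e -addmA [(U_(i) + m)%MM]addmC addmA; apply: lpp_mnmU; apply: IH => //.
by move: ltd; rewrite {1}e mdegD mdeg1 addn1.
Qed.

Lemma lppE (p : S) : reflect (forall m, m \in msupp p -> lpp_mnm m) (p \in lpp).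
Proof. exact: allP. Qed.

Lemma lppM (p q : S) : p \in lpp -> q * p \in lpp.
Proof.
move/lppE=> lp; apply/lppE=> m /msuppM_le/allpairsP[[m1 m2] [/= _ /lp l2 ->]].
exact: lpp_mnmD.
Qed.

Lemma lppD (p q : S) : p \in lpp -> q \in lpp -> p + q \in lpp.
Proof.
move=> /lppE lp /lppE lq; apply/lppE=> m /msuppD_le; rewrite mem_cat.
by move=> /orP[/lp|/lq].
Qed.

Lemma lpp0 : 0 \in lpp.
Proof. by apply/lppE=> m; rewrite msupp0. Qed.

Lemma lpp1 : 1 \notin lpp.
Proof.
apply/negP=> /lppE/(_ 0%MM); rewrite msupp1 inE eqxx => /(_ isT)/implyP.
have z : [forall i, ((0%MM : 'X_{1..N.+1}) i < a i)%N] by apply/forallP=> i; rewrite mnm0E.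
move/(_ z); rewrite mdeg0; suff -> : segment 0 = set0 by rewrite inE.
apply/eqP; rewrite -cards_eq0 -leqn0; apply: leq_trans (card_lseg_le _ _ _ _) _.
rewrite h0 leq_subLR addn0 -(cards1 (mkvec B (fun _ : 'I_N.+1 => 0%N))).
apply/subset_leq_card/subsetP=> v /boxP[_ dv]; rewrite inE; apply/eqP/vec_ext => i.
have : (v i <= deg v)%N by rewrite /deg (bigD1 i) //= leq_addr.
by rewrite dv leqn0 mkvecE // => /eqP.
Qed.

Lemma lpp_X m : lpp_mnm m -> 'X_[m] \in lpp.
Proof. by move=> lm; apply/lppE=> m'; rewrite msuppX inE => /eqP ->. Qed.

Lemma lpp_graded : graded_ideal lpp.
Proof.
split; first by split; [exact: lpp0|exact: lpp1|move=> c p q lp lq; apply: lppD => //; exact: lppM].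
pose G (p : S) := exists2 m, lpp_mnm m & p = 'X_[m].
have Gh g : G g -> exists d, g \is d.-homog.
  by move=> [m _ ->]; exists (mdeg m); rewrite dhomogX.
exists G; split=> // p; split.
  move/lppE=> lp; have hG := gen_ideal_hom_ideal Gh.
  rewrite [p]mpolyE big_seq; apply: (hom_ideal_sum _ hG) => m /lp lm.
  by apply: (hom_idealZ _ hG); apply: gen_ideal_gen; exists m.
apply: (@gen_ideal_min _ _ G (fun p => p \in lpp)); [exact: lpp0|exact: lppD|by move=> ? ?; exact: lppM|].
by move=> _ [m lm ->]; exact: lpp_X.
Qed.

Lemma lpp_power i : 'X_i ^+ a i \in lpp.
Proof.
rewrite mpolyXn; apply: lpp_X; apply/implyP=> /forallP/(_ i).
by rewrite mulmnE mnm1E eqxx mul1n ltnn.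
Qed.

(** The monomials of the box outside the segment form the basis. *)
Lemma dim_quotient_lpp t : dim_quotient lpp t (h t).
Proof.
pose D := box B a t :\: segment t.
have cD : #|D| = h t.
  rewrite cardsD (setIidPr (lseg_sub _ _ _ _)) card_lseg ?leq_subr // subKn //.
pose mof (v : vec B N.+1) : 'X_{1..N.+1} := [multinom v i | i < N.+1].
have mofE v i : mof v i = v i by rewrite mnmE.
have mofK v : expo (mof v) = v by apply: vec_ext => i; rewrite mkvecE mofE // vec_le.
have mofD v : v \in D -> mdeg (mof v) = t /\ ~~ lpp_mnm (mof v).
  move=> /setDP[/boxP[bv dv] nv].
  have dm : mdeg (mof v) = t by rewrite mdegE -dv; apply: eq_bigr => i _; exact: mofE.
  split=> //; rewrite /lpp_mnm dm mofK negb_imply nv andbT.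
  by apply/forallP=> i; rewrite mofE.
rewrite -cD; pose mo (j : 'I_#|D|) := mof (enum_val j).
have mo_inj : injective mo by move=> i j /(congr1 expo); rewrite !mofK; exact: enum_val_inj.
have moD j := mofD _ (enum_valP j).
have coef (c : 'I_#|D| -> k) m : (\sum_j c j *: 'X_[k, mo j])@_m = \sum_(j | mo j == m) c j.
  rewrite raddf_sum /= [RHS]big_mkcond; apply: eq_bigr => j _.
  by rewrite mcoeffZ mcoeffX; case: eqP => _; rewrite ?mulr1 ?mulr0.
have coefmo c j : (\sum_j c j *: 'X_[k, mo j])@_(mo j) = c j.
  by rewrite coef (eq_bigl (pred1 j)) ?big_pred1_eq // => i; rewrite (inj_eq mo_inj).
exists (fun j => 'X_[mo j]); split.
- by move=> j; rewrite dhomogX; case: (moD j) => /= ->.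
- move=> c /lppE lc j; apply/eqP; apply: contraT => nc.
  have [_ /negP[]] := moD j; apply: lc.
  by rewrite mcoeff_msupp coefmo.
move=> p ph; exists (fun j => p@_(mo j)); apply/lppE=> m.
set q := p - _; have qh : q \is t.-homog.
  apply: rpredB => //; apply: rpred_sum => j _; apply: rpredZ; rewrite dhomogX.
  by case: (moD j) => /= ->.
move=> mq; have dm : mdeg m = t := dhomog_mf qh mq.
apply/implyP=> /forallP bm; rewrite dm; apply: contraLR mq => nm.
have mD : expo m \in D by rewrite inE nm -dm expo_box.
have me : mo (enum_rank_in mD (expo m)) = m.
  by apply/mnmP=> i; rewrite /mo enum_rankK_in // mofE expoE.
by rewrite -mcoeff_eq0 mcoeffB -{2}me coefmo me subrr.
Qed.

End MonomialIdeal.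

(** * The theorem *)

Lemma homog_prod_linear (k : fieldType) (n : nat) (s : seq {mpoly k[n]}) :
  (forall l, l \in s -> l \is 1.-homog) -> \prod_(l <- s) l \is (size s).-homog.
Proof.
elim: s => [|l s IH] sh; first by rewrite big_nil dhomog1.
rewrite big_cons /= -add1n; apply: dhomogM; first by apply: sh; rewrite mem_head.
by apply: IH => l' l's; apply: sh; rewrite in_cons l's orbT.
Qed.

(** A zero entry would force the previous ones to generate the unit ideal. *)
Lemma regular_sequence_neq0 (R : comNzRingType) r (f : 'I_r -> R) i :
  regular_sequence f -> f i != 0.
Proof.
move=> [freg not1]; apply/eqP => fi0; apply: not1.
have [|r' [c [g [gP ->]]]] := freg i 1.
  by rewrite fi0 mulr0; exists 0%N, (fun=> 0), (fun=> 0); split=> [[]//|]; rewrite big_ord0.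
by exists r', c, g; split=> // j; have [l _ ->] := gP j; exists l.
Qed.

Theorem corollary4p3 (k : fieldType) (n : nat) (n_ge1 : (1 <= n)%N)
    (a : 'I_n -> nat)
    (a_ge2 : forall i, (2 <= a i)%N)
    (a_mono : forall i j : 'I_n, (i <= j)%N -> (a i <= a j)%N)
    (I : {pred {mpoly k[n]}}) (I_graded : graded_ideal I)
    (f : 'I_n -> {mpoly k[n]})
    (f_in : forall i, f i \in I)
    (f_homog : forall i, f i \is (a i).-homog)
    (f_regular : regular_sequence f)
    (f_split : forall i, splits_into_linear_factors (f i)) :
  exists J : {pred {mpoly k[n]}},
    [/\ graded_ideal J,
        forall i : 'I_n, 'X_i ^+ a i \in J
      & forall t : nat, exists m : nat,
          dim_quotient I t m /\ dim_quotient J t m].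
Proof.
case: n n_ge1 a a_ge2 a_mono I I_graded f f_in f_homog f_regular f_split => // N _
  a a_ge2 a_mono I I_graded f f_in f_homog f_regular f_split.
have [L Lf] := fin_all_exists f_split.
have Lh i : forall l, l \in L i -> l \is 1.-homog by case: (Lf i).
have fL i : f i = \prod_(l <- L i) l by case: (Lf i).
have La i : size (L i) = a i.
  apply: (@dhomog_uniq _ _ mdeg (f i)) (f_homog i); first exact: regular_sequence_neq0.
  by rewrite fL; apply: homog_prod_linear; exact: Lh.
pose B := (\max_i a i)%N.
have aB i : (a i <= B.+1)%N by rewrite leqW // (bigmax_sup i).
have hI := graded_ideal_hom_ideal I_graded.
pose h := hilb (fun p => p \in I).
have growthI t : (h t <= #|box B a t|)%N /\
    (h t.+1 + growth B a t (#|box B a t| - h t) <= #|box B a t.+1|)%N.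
  apply: (@hilb_growth _ _ _ _ a L) => //.
    by move=> i; rewrite -fL.
  move=> c cL x; have [q ->] := regular_transversal f_homog f_regular fL Lh cL x.
  by exists q; rewrite subrr; exact: hom_ideal0 hI.
have h0 : h 0%N = 1%N.
  apply/eqP; rewrite eqn_leq; apply/andP; split.
    by apply: leq_trans (leq_subr _ _) _; rewrite dim_form bin0.
  rewrite lt0n; apply/eqP => /(hilb0_full hI)/(_ _ (dhomog1 _ _)).
  by case: I_graded => -[_ /negP].
exists (@lpp k N B a h); split.
- by apply: lpp_graded => // [i|t|t]; [exact: leq_trans (a_ge2 i)|case: (growthI t)|case: (growthI t)].
- by move=> i; exact: lpp_power.
move=> t; exists (h t); split; first exact: dim_quotient_hilb.
by apply: dim_quotient_lpp => // t'; case: (growthI t').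
Qed.
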